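(* Let $1<p<\infty$, $\lambda_\pm>0$, $0<\gamma<\min\left\{1,\frac{p\alpha_p}{1+\alpha_p}\right\}$, $\tau:=\gamma/(p-\gamma)$. Let $u$ be a local minimizer of $\mathcal{J}$, $\Omega'\Subset\Omega$ open, and let $\rho_0,C_2$ be the growth constants associated with $u$ and $\Omega'$. There exists $c>0$, depending on $C_1$ and $c_\pm$, such that, if $z_\pm\in\Gamma_0\cap\partial\{u_\pm>0\}\cap\Omega'$, then for any $0<r<\rho_0$ $$\mathcal{L}^N(B_{cr})\le\mathcal{L}^N\big(\{0<u_\pm\le C_2r^{1+\tau}\}\cap B_r(z_\pm)\big),$$ where the statement is understood separately for the sign $+$ and for the sign $-$.
   Context: $\Omega\subset\mathbb{R}^N$ is open and bounded with Lipschitz boundary. The functional is $$\mathcal{J}[u]:=\int_\Omega \frac{|\nabla u|^p}{p}+F_\gamma(u)\,dx,\qquad F_\gamma(u):=\lambda_+(u_+)^\gamma+\lambda_-(u_-)^\gamma,\qquad u_\pm:=\max\{\pm u,0\}.$$ A function $u\in W^{1,p}(\Omega)$ is a local minimizer of $\mathcal{J}$ if $\mathcal{J}[u]\le\mathcal{J}[u+\varphi]$ for every open $\Omega'\Subset\Omega$ and every $\varphi\in W^{1,p}_0(\Omega')$ (extended by zero). Local minimizers belong to $C^{1,\alpha}_{\mathrm{loc}}(\Omega)$ for some $\alpha\in(0,1)$. The free boundary is $\Gamma:=(\partial\{u>0\}\cup\partial\{u<0\})\cap\Omega$ and $\Gamma_0:=\Gamma\cap\{\nabla u=0\}$. $\alpha_p\in(0,1)$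 (depending only on $N,p$) denotes the optimal Hölder exponent for the gradient of $p$-harmonic functions in $\mathbb{R}^N$; in particular, $p$-harmonic functions satisfy interior $C^{1,\alpha_p}$ estimates. $B_\rho:=B_\rho(0)$ and $\mathcal{L}^N$ is Lebesgue measure. Constants: (growth) $0<\rho_0<\operatorname{dist}(\Omega',\partial\Omega)$ and $C_2>0$ are constants such that $\sup_{B_r(z)}|u|\le C_2r^{1+\tau}$ for all $z\in\Gamma_0\cap\Omega'$ and $0<r<\rho_0$ (they exist for $\gamma$ in the stated range); (nondegeneracy) $c_\pm>0$, depending only on $p,\gamma,\lambda_\pm,N$, are constants such that $\sup_{B_r(x_0)}u_\pm\ge c_\pm r^{1+\tau}$ whenever $x_0\in\overline{\{u_\pm>0\}}$ and $r<\operatorname{dist}(x_0,\partial\Omega)$; $C_1$ is the constant in the interior $C^{1,\alpha}$ estimate for local minimizers of $\mathcal{J}$ (applied to rescaled minimizers on the unit ball that are bounded by $C_2$). *)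

(* Defs.v *)
From HB Require Import structures.
From mathcomp Require Import all_boot all_order all_algebra.
From mathcomp Require Import all_classical all_reals all_analysis.

Set Implicit Arguments.
Unset Strict Implicit.
Unset Printing Implicit Defensive.

Import Order.TTheory GRing.Theory Num.Theory.
Import numFieldNormedType.Exports.

Local Open Scope classical_set_scope.
Local Open Scope ring_scope.

(** Points of R^N, N >= 1, are row vectors ['rV[R]_n.+1] with N = n.+1.  The
    library's topology on them is the usual one, but its norm is the sup norm;
    balls, distances and gradient lengths use [enorm] below. *)

Definition dotv (R : realType) (m : nat) (x y : 'rV[R]_m) : R :=
  \sum_i x 0 i * y 0 i.

Definition enorm (R : realType) (m : nat) (x : 'rV[R]_m) : R :=
  Num.sqrt (dotv x x).

Definition eball (R : realType) (m : nat) (x : 'rV[R]_m) (r : R) :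
  set 'rV[R]_m := [set y | enorm (y - x) < r].

Definition set_dist (R : realType) (m : nat) (A B : set 'rV[R]_m) : \bar R :=
  ereal_inf [set (enorm (q.1 - q.2))%:E | q in A `*` B].

Definition boundary (T : topologicalType) (A : set T) : set T :=
  closure A `\` interior A.

Definition compactly_contained (T : topologicalType) (A B : set T) : Prop :=
  compact (closure A) /\ closure A `<=` B.

(** Lebesgue measure on R^N: the outer measure defined by countable covers by
    closed boxes, restricted to its Caratheodory sigma-algebra. *)

Definition box (R : realType) (m : nat) (ab : 'rV[R]_m * 'rV[R]_m) :
  set 'rV[R]_m := [set x | forall i, ab.1 0 i <= x 0 i <= ab.2 0 i].

Definition box_volume (R : realType) (m : nat)
    (ab : 'rV[R]_m * 'rV[R]_m) : R :=
  \prod_i Num.max (ab.2 0 i - ab.1 0 i) 0.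

Definition box_cover (R : realType) (m : nat) (A : set 'rV[R]_m) :
    set (nat -> 'rV[R]_m * 'rV[R]_m) :=
  [set Q | A `<=` \bigcup_k box (Q k)].

Definition lebesgue_outer (R : realType) (n : nat) (A : set 'rV[R]_n.+1) :
    \bar R :=
  ereal_inf [set (\sum_(k <oo) (box_volume (Q k))%:E)%E | Q in box_cover A].

Lemma box_volume_ge0 (R : realType) (m : nat) (ab : 'rV[R]_m * 'rV[R]_m) :
  0 <= box_volume ab.
Proof. by apply: prodr_ge0 => i _; rewrite le_max lexx orbT. Qed.

Lemma lebesgue_outer_ge0 (R : realType) (n : nat) (A : set 'rV[R]_n.+1) :
  (0 <= lebesgue_outer A)%E.
Proof.
apply: le_ereal_inf_tmp => x [Q _ <-]; apply: nneseries_ge0 => k _ _.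
by rewrite lee_fin box_volume_ge0.
Qed.

Lemma lebesgue_outer0 (R : realType) (n : nat) :
  lebesgue_outer (set0 : set 'rV[R]_n.+1) = 0%E.
Proof.
apply/eqP; rewrite eq_le; apply/andP; split; last exact: lebesgue_outer_ge0.
apply: ereal_inf_lbound; exists (fun=> (0, 0)) => //.
apply: eseries0 => k _ _; congr EFin.
by rewrite /box_volume big_ord_recl /= subrr maxxx mul0r.
Qed.

Lemma le_lebesgue_outer (R : realType) (n : nat) :
  {homo @lebesgue_outer R n : A B / A `<=` B >-> (A <= B)%E}.
Proof.
move=> A B AB; apply/ereal_inf_le_tmp => x [Q BQ <-].
by exists Q => //; exact: subset_trans BQ.
Qed.

Lemma lebesgue_outer_sigma_subadditive (R : realType) (n : nat) :
  sigma_subadditive (@lebesgue_outer R n).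
Proof.
move=> A; have [[i ioo]|] := pselect (exists i, lebesgue_outer (A i) = +oo%E).
  rewrite (eseries_pinfty _ _ ioo) ?leey// => k _.
  by rewrite -ltNye (lt_le_trans _ (lebesgue_outer_ge0 _)).
rewrite -forallNE => Aoo.
suff add2e (e : {posnum R}) : (lebesgue_outer (\bigcup_k A k) <=
    \sum_(i <oo) lebesgue_outer (A i) + e%:num%:E)%E.
  by apply/lee_addgt0Pr => _/posnumP[].
rewrite (le_trans _ (epsilon_trick _ _ _))//; last first.
  by move=> k; exact: lebesgue_outer_ge0.
pose vol ab : \bar R := (@box_volume R n.+1 ab)%:E.
have vol0 ab : (0 <= vol ab)%E by rewrite lee_fin box_volume_ge0.
pose P k Q := box_cover (A k) Q /\ (\sum_(j <oo) vol (Q j) <=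
  lebesgue_outer (A k) + (e%:num / (2 ^ k.+1)%:R)%:E)%E.
have [G PG] : {G & forall k, P k (G k)}.
  apply: (@choice _ _ P) => k; rewrite /P /lebesgue_outer.
  set S := (X in ereal_inf X); move infS : (ereal_inf S) => iS.
  case: iS infS => [r Sr|Soo|Soo].
  - have en1 : (0 < e%:num / (2 ^ k.+1)%:R)%R by [].
    have /(lb_ereal_inf_adherent en1) : ereal_inf S \is a fin_num by rewrite Sr.
    move=> [x [Q AQ muQx] xS].
    by exists Q; split => //; rewrite muQx -Sr; exact/ltW.
  - by have := Aoo k; rewrite /lebesgue_outer Soo.
  - suff : lbound S 0%E by move/le_ereal_inf_tmp; rewrite Soo.
    by move=> /= _ [Q AQ <-]; apply: nneseries_ge0 => j _ _; exact: vol0.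
have volG_ge0 x : (0 <= (vol \o uncurry G) x)%E by exact: vol0.
apply: (@le_trans _ _ (\esum_(i in setT) (vol \o uncurry G) i)%E).
  apply: ereal_inf_lbound => /=.
  have /card_esym/ppcard_eqP[f] := card_nat2.
  exists (uncurry G \o f).
    move=> t [k _ /(PG k).1 [j _ Gkjt]]; exists (f^-1%FUN (k, j)) => //=.
    by rewrite invK ?inE.
  rewrite -(esum_pred_image (vol \o uncurry G) _ xpredT) ?[fun=> _]set_true//.
  by rewrite image_eq.
rewrite (_ : esum _ _ = (\sum_(i <oo) \sum_(j <oo) vol (G i j))%E); last first.
  pose J : nat -> set (nat * nat) := fun i => [set (i, j) | j in setT].
  rewrite (_ : setT = \bigcup_k J k); last first.
    by rewrite predeqE => -[a b]; split => // _; exists a => //; exists b.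
  rewrite esum_bigcupT /=; last 2 first.
    - apply/trivIsetP => i j _ _ ij.
      rewrite predeqE => -[k m] /=; split => //= -[] [_] _ [<-{k} _].
      by move=> [m' _] [] /esym/eqP; rewrite (negbTE ij).
    - by move=> /= [k m]; exact: vol0.
  rewrite -(image_id [set: nat]) -fun_true esum_pred_image//; last first.
    by move=> k _; exact: esum_ge0.
  apply: eq_eseriesr => /= j _.
  rewrite -(esum_pred_image (vol \o uncurry G) (pair j) predT)//=; last first.
    by move=> ? ? _ _; exact: (@can_inj _ _ _ snd).
  by congr esum; rewrite predeqE => -[a b]; split; move=> [i _ <-]; exists i.
apply: lee_lim.
- apply: is_cvg_nneseries => k *.
  by apply: nneseries_ge0 => m *; exact: (volG_ge0 (k, m)).
- apply: is_cvg_nneseries => k *; apply: adde_ge0 => //.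
  exact: lebesgue_outer_ge0.
- by near=> k; apply: lee_sum => i _; exact: (PG i).2.
Unshelve. all: by end_near. Qed.

HB.instance Definition _ (R : realType) (n : nat) :=
  isOuterMeasure.Build R 'rV[R]_n.+1 (@lebesgue_outer R n)
    (@lebesgue_outer0 R n) (@lebesgue_outer_ge0 R n) (@le_lebesgue_outer R n)
    (@lebesgue_outer_sigma_subadditive R n).

Definition lebesgue_outer_measure (R : realType) (n : nat) :
  {outer_measure set 'rV[R]_n.+1 -> \bar R} := @lebesgue_outer R n.

(** [Rn R n] is ['rV[R]_n.+1] carrying the Lebesgue measurable sets. *)
Notation Rn R n := (caratheodory_type (lebesgue_outer_measure R n)).

Definition lebesgueN (R : realType) (n : nat) :
    {measure set (Rn R n) -> \bar R} :=
  (lebesgue_outer_measure R n : set (Rn R n) -> \bar R).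

Definition int_Rn (R : realType) (n : nat) (D : set 'rV[R]_n.+1)
    (f : 'rV[R]_n.+1 -> R) : \bar R :=
  (\int[@lebesgueN R n]_(x in (D : set (Rn R n))) (f x)%:E)%E.

Definition in_Lp (R : realType) (n : nat) (p : R) (D : set 'rV[R]_n.+1)
    (f : 'rV[R]_n.+1 -> R) : Prop :=
  measurable_fun (D : set (Rn R n)) (f : Rn R n -> R) /\
  (int_Rn D (fun x => `|f x| `^ p)%R < +oo)%E.

Definition grad (R : realType) (m : nat) (f : 'rV[R]_m -> R) (x : 'rV[R]_m) :
  'rV[R]_m := \row_i 'D_(delta_mx 0 i) f x.

Fixpoint is_Ck (R : realType) (m k : nat) (f : 'rV[R]_m -> R) : Prop :=
  if k is k'.+1 then
    (forall x, differentiable f x) /\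
    (forall i, is_Ck k' (fun x => grad f x 0 i))
  else continuous f.

(** C_c^oo(D), extended by zero. *)
Definition test_function (R : realType) (m : nat) (D : set 'rV[R]_m)
    (phi : 'rV[R]_m -> R) : Prop :=
  (forall k, is_Ck k phi) /\
  (compact (closure [set x | phi x != 0]) /\
   closure [set x | phi x != 0] `<=` D).

(** Sobolev functions come with their weak gradient: [W1p p D u G] says that
    u is in W^{1,p}(D) with weak gradient G.  Values off D are irrelevant. *)

Definition weak_gradient (R : realType) (n : nat) (D : set 'rV[R]_n.+1)
    (u : 'rV[R]_n.+1 -> R) (G : 'rV[R]_n.+1 -> 'rV[R]_n.+1) : Prop :=
  forall phi, test_function D phi -> forall i,
    int_Rn D (fun x => u x * grad phi x 0 i) =
    (- int_Rn D (fun x => G x 0 i * phi x)%R)%E.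

Definition W1p (R : realType) (n : nat) (p : R) (D : set 'rV[R]_n.+1)
    (u : 'rV[R]_n.+1 -> R) (G : 'rV[R]_n.+1 -> 'rV[R]_n.+1) : Prop :=
  [/\ in_Lp p D u,
      forall i, in_Lp p D (fun x => G x 0 i) &
      weak_gradient D u G].

(** Closure of C_c^oo(D) in W^{1,p}(D); its elements are extended by zero. *)
Definition W1p0 (R : realType) (n : nat) (p : R) (D : set 'rV[R]_n.+1)
    (phi : 'rV[R]_n.+1 -> R) (H : 'rV[R]_n.+1 -> 'rV[R]_n.+1) : Prop :=
  [/\ W1p p D phi H,
      forall x, ~ D x -> phi x = 0 /\ H x = 0 &
      exists f : nat -> 'rV[R]_n.+1 -> R,
        [/\ forall k, test_function D (f k),
            (fun k => int_Rn D (fun x => `|f k x - phi x| `^ p))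
              @ \oo --> 0%E &
            (fun k => int_Rn D (fun x => enorm (grad (f k) x - H x) `^ p))
              @ \oo --> 0%E]].

(** J[u] over Omega; G stands for the weak gradient of u, and [u^\+], [u^\-]
    are the library's positive and negative parts u_+, u_-. *)
Definition functionalJ (R : realType) (n : nat) (p lp lm gam : R)
    (Omega : set 'rV[R]_n.+1) (u : 'rV[R]_n.+1 -> R)
    (G : 'rV[R]_n.+1 -> 'rV[R]_n.+1) : \bar R :=
  int_Rn Omega (fun x => enorm (G x) `^ p / p +
    (lp * (u^\+ x) `^ gam + lm * (u^\- x) `^ gam)).

Definition local_minimizer (R : realType) (n : nat) (p lp lm gam : R)
    (Omega : set 'rV[R]_n.+1) (u : 'rV[R]_n.+1 -> R) : Prop :=
  exists2 G, W1p p Omega u G &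
    forall Omega' phi H, open Omega' -> compactly_contained Omega' Omega ->
      W1p0 p Omega' phi H ->
      (functionalJ p lp lm gam Omega u G <=
       functionalJ p lp lm gam Omega (u \+ phi)%R (G \+ H)%R)%E.

(** Norm of C^{1,a}(D): sup |u| + sup |grad u| + a-Hoelder seminorm of grad u. *)
Definition C1a_norm (R : realType) (m : nat) (a : R) (D : set 'rV[R]_m)
    (u : 'rV[R]_m -> R) : \bar R :=
  (ereal_sup [set `|u x|%:E | x in D] +
   ereal_sup [set (enorm (grad u x))%:E | x in D] +
   ereal_sup [set (enorm (grad u q.1 - grad u q.2) /
                   enorm (q.1 - q.2) `^ a)%:E
             | q in [set q | [/\ D q.1, D q.2 & q.1 != q.2]]])%E.

Definition C1a_loc (R : realType) (m : nat) (a : R) (D : set 'rV[R]_m)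
    (u : 'rV[R]_m -> R) : Prop :=
  (forall x, D x -> differentiable u x) /\
  (forall D', open D' -> compactly_contained D' D ->
    (C1a_norm a D' u < +oo)%E).

(** Local minimizers are determined up to null sets; the pointwise objects
    below refer to the C^{1,a}_loc representative. *)
Definition C1_local_minimizer (R : realType) (n : nat) (p lp lm gam : R)
    (Omega : set 'rV[R]_n.+1) (u : 'rV[R]_n.+1 -> R) : Prop :=
  local_minimizer p lp lm gam Omega u /\
  exists2 a : R, 0 < a < 1 & C1a_loc a Omega u.

Definition p_harmonic (R : realType) (n : nat) (p : R) (D : set 'rV[R]_n.+1)
    (h : 'rV[R]_n.+1 -> R) : Prop :=
  exists2 G : 'rV[R]_n.+1 -> 'rV[R]_n.+1,
    (forall D', open D' -> compactly_contained D' D -> W1p p D' h G) &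
    forall phi, test_function D phi ->
      int_Rn D (fun x =>
        enorm (G x) `^ (p - 2) * dotv (G x) (grad phi x)) = 0%E.

(** Interior C^{1,a} estimate for p-harmonic functions (h' is the C^1
    representative of h). *)
Definition p_harmonic_estimate (R : realType) (n : nat) (p a : R) : Prop :=
  exists C : R, forall (h : 'rV[R]_n.+1 -> R) (M : R),
    p_harmonic p (eball 0 1) h ->
    (forall x, eball 0 1 x -> `|h x| <= M) ->
    exists h' : 'rV[R]_n.+1 -> R,
      [/\ {ae @lebesgueN R n, forall x, eball 0 1 x -> h x = h' x},
          C1a_loc a (eball 0 1) h' &
          (C1a_norm a (eball (0 : 'rV[R]_n.+1) (2^-1)) h' <= (C * M)%:E)%E].

(** The optimal gradient exponent, as a supremum over (0,1): the value is
    meaningful whether or not it is attained (for p = 2 it is 1). *)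
Definition alpha_p (R : realType) (n : nat) (p : R) : R :=
  sup [set a : R | 0 < a < 1 /\ p_harmonic_estimate n p a].

(** Near each boundary point, and after an orthogonal change of coordinates Q,
    D is the strict epigraph of a Lipschitz function of the first N-1
    coordinates. *)
Definition lipschitz_boundary (R : realType) (n : nat)
    (D : set 'rV[R]_n.+1) : Prop :=
  forall x0, boundary D x0 ->
    exists (Q : 'M[R]_n.+1) (g : 'rV[R]_n -> R) (L rho : R),
      [/\ Q *m Q^T = 1%:M, 0 < rho,
          forall y y', `|g y - g y'| <= L * enorm (y - y') &
          forall x, eball x0 rho x ->
            (D x <-> g (col' ord_max (x *m Q)) < (x *m Q) 0 ord_max)].

Definition positivity_set (R : realType) (m : nat) (Omega : set 'rV[R]_m)
    (w : 'rV[R]_m -> R) : set 'rV[R]_m := Omega `&` [set x | 0 < w x].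

Definition free_boundary (R : realType) (m : nat) (Omega : set 'rV[R]_m)
    (u : 'rV[R]_m -> R) : set 'rV[R]_m :=
  (boundary (Omega `&` [set x | 0 < u x]) `|`
   boundary (Omega `&` [set x | u x < 0])) `&` Omega.

Definition free_boundary0 (R : realType) (m : nat) (Omega : set 'rV[R]_m)
    (u : 'rV[R]_m -> R) : set 'rV[R]_m :=
  free_boundary Omega u `&` [set x | grad u x = 0].

(** u_+ for [s = true], u_- for [s = false]. *)
Definition signed_part (R : realType) (m : nat) (s : bool)
    (u : 'rV[R]_m -> R) : 'rV[R]_m -> R := if s then u^\+ else u^\-.

(** The suprema below are taken in the extended reals, where the supremum of
    an unbounded set is +oo. *)

Definition growth_constants (R : realType) (n : nat) (tau : R)
    (Omega Omega' : set 'rV[R]_n.+1) (u : 'rV[R]_n.+1 -> R)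
    (rho0 C2 : R) : Prop :=
  [/\ 0 < rho0, (rho0%:E < set_dist Omega' (boundary Omega))%E, 0 < C2 &
      forall z r, (free_boundary0 Omega u `&` Omega') z -> 0 < r < rho0 ->
        (ereal_sup [set `|u y|%:E | y in eball z r] <=
         (C2 * r `^ (1 + tau))%:E)%E].

Definition nondegeneracy_constant (R : realType) (n : nat) (tau : R)
    (Omega : set 'rV[R]_n.+1) (w : 'rV[R]_n.+1 -> R) (c : R) : Prop :=
  forall x0 r, closure (positivity_set Omega w) x0 ->
    0 < r -> (r%:E < set_dist [set x0] (boundary Omega))%E ->
    ((c * r `^ (1 + tau))%:E <= ereal_sup [set (w y)%:E | y in eball x0 r])%E.

(** C1 bounds the C^{1,a} norm on B_{1/2} of every local minimizer on B_1 that
    is bounded by M. *)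
Definition interior_constant (R : realType) (n : nat) (p lp lm gam a M C1 : R)
    : Prop :=
  forall v : 'rV[R]_n.+1 -> R,
    C1_local_minimizer p lp lm gam (eball 0 1) v ->
    (forall x, eball 0 1 x -> `|v x| <= M) ->
    (C1a_norm a (eball (0 : 'rV[R]_n.+1) (2^-1)) v <= C1%:E)%E.

(* Main.v *)
(** The Euler-Lagrange scaling [v x = u (z + r x) / r^(1+tau)] turns [u] into a
    local minimizer on the unit ball, which the growth estimate bounds by [C2];
    hence [|grad v| <= C1] on the half ball.  Nondegeneracy on [B_(r/4)(z)]
    yields a point where the signed part of [v] exceeds a positive constant
    depending only on [cs] and [tau], so by the mean value theorem that part
    stays positive on a ball of radius [c] around it.  Scaling back gives a
    ball of radius [c r], inside the set whose measure is to be estimated. *)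

Require Import Defs.
From mathcomp Require Import all_boot all_order all_algebra.
From mathcomp Require Import all_classical all_reals all_analysis.
From mathcomp Require Import measurable_realfun lebesgue_integral.
From mathcomp Require Import ring lra.
Import Order.TTheory GRing.Theory Num.Theory.
Import numFieldNormedType.Exports.
Local Open Scope classical_set_scope.
Local Open Scope ring_scope.

(** * Euclidean norm *)

(** The value tau = gam / (p - gam) is what makes the scaling work: with k = r^-(1+tau) it gives (k
    r)^p = k^gam, so the gradient term and both potential terms acquire the same factor and the
    energy is only multiplied by a positive constant. The obstacle is that minimality of [u]
    compares energies over all of [Omega], while [v] has to minimize an energy over the unit ball,
    that is, over B_r(z). A competitor changes nothing outside its support, so the common energy of
    the complement can be cancelled, provided that it is finite; boundedness of [Omega] and gam < p
    ensure this. The change of variables starts from box covers under x -> z + r x, from which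
    measure, integrals, weak gradients and W_0^{1,p} follow in turn. The radius r/4 and the bound c
    <= 1/4 keep the chosen point and its neighbourhood in the half ball, where the gradient is
    controlled. *)

Lemma continuous_affine (R : realType) (V : normedModType R) (z : V) (r : R) :
  continuous (fun x => z + r *: x).
Proof. by move=> x; apply: cvgD; [exact: cvg_cst|exact: scaler_continuous]. Qed.

Section euclidean.
Context {R : realType} {m : nat}.
Implicit Types (x y z : 'rV[R]_m) (r : R).

Lemma dotvC x y : dotv x y = dotv y x.
Proof. by apply: eq_bigr => i _; rewrite mulrC. Qed.

Lemma dotvDl x y z : dotv (x + y) z = dotv x z + dotv y z.
Proof. by rewrite /dotv -big_split; apply: eq_bigr => i _; rewrite mxE mulrDl. Qed.

Lemma dotvZl r x y : dotv (r *: x) y = r * dotv x y.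
Proof. by rewrite /dotv mulr_sumr; apply: eq_bigr => i _; rewrite mxE mulrA. Qed.

Lemma dotvDr x y z : dotv z (x + y) = dotv z x + dotv z y.
Proof. by rewrite dotvC dotvDl !(dotvC z). Qed.

Lemma dotvZr r x y : dotv x (r *: y) = r * dotv x y.
Proof. by rewrite dotvC dotvZl dotvC. Qed.

Lemma dotv_ge0 x : 0 <= dotv x x.
Proof. by apply: sumr_ge0 => i _; rewrite -expr2 sqr_ge0. Qed.

Lemma sqr_enorm x : enorm x ^+ 2 = dotv x x.
Proof. by rewrite sqr_sqrtr// dotv_ge0. Qed.

Lemma enorm_ge0 x : 0 <= enorm x.
Proof. exact: sqrtr_ge0. Qed.

Lemma enormZ r x : enorm (r *: x) = `|r| * enorm x.
Proof.
by rewrite /enorm dotvZl dotvZr mulrA -expr2 sqrtrM ?sqr_ge0// sqrtr_sqr.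
Qed.

Lemma enormN x : enorm (- x) = enorm x.
Proof. by rewrite -scaleN1r enormZ normrN1 mul1r. Qed.

Lemma enorm0 : enorm (0 : 'rV[R]_m) = 0.
Proof. by rewrite -(scale0r 0) enormZ normr0 mul0r. Qed.

Lemma enormB x y : enorm (x - y) = enorm (y - x).
Proof. by rewrite -opprB enormN. Qed.

(** Cauchy-Schwarz: the squared length of |y|^2 x - (x.y) y equals |y|^2 (|x|^2 |y|^2 - (x.y)^2).
    Dividing by |y|^2 requires y to be nonzero, hence the case split. *)
Lemma norm_dotv_le x y : `|dotv x y| <= enorm x * enorm y.
Proof.
rewrite -ler_sqr ?nnegrE ?normr_ge0 ?mulr_ge0 ?enorm_ge0//.
rewrite exprMn !sqr_enorm real_normK ?num_real//.
have [y0|y0] := eqVneq (dotv y y) 0.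
  have -> : y = 0.
    apply/rowP => i; apply/eqP; rewrite mxE -sqrf_eq0.
    move/eqP: y0; rewrite psumr_eq0 => [|j _]; last by rewrite -expr2 sqr_ge0.
    by move=> /allP/(_ i); rewrite mem_index_enum -expr2 => /(_ isT).
  by rewrite -(scale0r 0) !dotvZr !mul0r expr0n mulr0.
have := dotv_ge0 (dotv y y *: x + (- dotv x y) *: y).
rewrite !(dotvDl, dotvDr, dotvZl, dotvZr) (dotvC y x).
have y1 : 0 < dotv y y by rewrite lt_neqAle eq_sym y0 dotv_ge0.
set A := dotv x x; set B := dotv y y in y1 *; set C := dotv x y.
rewrite (_ : _ + _ = B * (A * B - C ^+ 2)); last by ring.
by rewrite pmulr_rge0// subr_ge0.
Qed.

Lemma enorm_triangle x y : enorm (x + y) <= enorm x + enorm y.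
Proof.
rewrite -ler_sqr ?nnegrE ?addr_ge0 ?enorm_ge0//.
rewrite sqrrD !sqr_enorm dotvDl !dotvDr (dotvC y x).
have := le_trans (ler_norm _) (norm_dotv_le x y).
by lra.
Qed.

Lemma eball_center x r : 0 < r -> eball x r x.
Proof. by rewrite /eball /= subrr enorm0. Qed.

Lemma subset_eball x y r r' : enorm (y - x) + r' <= r -> eball y r' `<=` eball x r.
Proof.
rewrite /eball => h w /= wy; apply: lt_le_trans h.
rewrite (_ : w - x = (y - x) + (w - y)); last first.
  by apply/rowP => i; rewrite !mxE; ring.
by apply: (le_lt_trans (enorm_triangle _ _)); rewrite ltrD2l.
Qed.

Lemma eball_segment x y w r t : eball x r y -> eball x r w -> 0 <= t <= 1 ->
  eball x r (y + t *: (w - y)).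
Proof.
rewrite /eball /= => xy xw /andP[t0 t1].
rewrite [X in enorm X](_ : _ = (1 - t) *: (y - x) + t *: (w - x)); last first.
  by apply/rowP => i; rewrite !mxE; ring.
apply: le_lt_trans (enorm_triangle _ _) _.
rewrite !enormZ ger0_norm ?subr_ge0// ger0_norm//.
(* For t > 0 the strict bound on w suffices; at t = 0 its weight vanishes and strictness must come
   from y. *)
have [->|t'0] := eqVneq t 0; first by rewrite subr0 mul1r mul0r addr0.
have t2 : 0 < t by rewrite lt_neqAle eq_sym t'0.
by nra.
Qed.

Lemma continuous_enorm : continuous (@enorm R m).
Proof.
move=> x; apply: (@continuous_comp _ _ _ (fun y => dotv y y)).
  move: x; apply: (@continuous_big R _ +%R 0 xpredT) => [y|i _ y].
    exact: add_continuous.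
  by apply: continuousM; exact: coord_continuous.
exact: sqrt_continuous.
Qed.

Lemma open_eball x r : open (eball x r).
Proof.
rewrite (_ : eball x r = (fun y => enorm (y - x)) @^-1` [set t | t < r])//.
apply: open_comp => [y _|]; last exact: open_lt.
apply: continuous_comp; last exact: continuous_enorm.
have := @continuous_affine R 'rV[R]_m (- x) 1.
by move=> /(_ y); under eq_fun do rewrite scale1r addrC.
Qed.

End euclidean.

(** * Lebesgue measurability of open sets *)

Section boxes.
Context {R : realType} {n : nat}.
Implicit Types (A X : set 'rV[R]_n.+1).

Definition box_cut_le (i : 'I_n.+1) (t : R) (ab : 'rV[R]_n.+1 * 'rV[R]_n.+1) :=
  (ab.1, \row_j if j == i then Num.min (ab.2 0 j) t else ab.2 0 j).

Definition box_cut_ge (i : 'I_n.+1) (t : R) (ab : 'rV[R]_n.+1 * 'rV[R]_n.+1) :=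
  (\row_j if j == i then Num.max (ab.1 0 j) t else ab.1 0 j, ab.2).

(** The cut changes only the i-th factor. When t misses the i-th side, one piece has a nonpositive
    side, which the [Num.max _ 0] in [box_volume] counts as 0. *)
Lemma box_volume_cut i t ab :
  box_volume (box_cut_le i t ab) + box_volume (box_cut_ge i t ab) =
  box_volume ab.
Proof.
rewrite /box_volume (bigD1 i)//= [X in _ + X](bigD1 i)//= [RHS](bigD1 i)//=.
rewrite !mxE !eqxx.
under eq_bigr => j /negbTE ji do rewrite !mxE ji.
under [X in _ + _ * X = _]eq_bigr => j /negbTE ji do rewrite !mxE ji.
rewrite -mulrDl; congr (_ * _).
set a := ab.1 0 i; set b := ab.2 0 i.
by rewrite !maxEle !minEle; do 5?case: ifPn; rewrite -?ltNge => *; lra.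
Qed.

(** Cutting every box of a cover of X along the hyperplane x_i = t yields covers of the two parts of
    X with the same total volume, which is the Caratheodory inequality. *)
Lemma measurable_halfspace i t :
  measurable ([set x : 'rV[R]_n.+1 | x 0 i <= t] : set (Rn R n)).
Proof.
apply: (@le_caratheodory_measurable R _ (lebesgue_outer_measure R n)) => X.
apply: le_ereal_inf_tmp => _ [Q QX <-].
rewrite (_ : (\sum_(k <oo) _)%E = (\sum_(k <oo)
    ((box_volume (box_cut_le i t (Q k)))%:E +
     (box_volume (box_cut_ge i t (Q k)))%:E))%E); last first.
  by apply: eq_eseriesr => k _; rewrite -EFinD box_volume_cut.
rewrite nneseriesD; try by move=> *; rewrite lee_fin box_volume_ge0.
apply: leeD; apply: ereal_inf_lbound.
- exists (fun k => box_cut_le i t (Q k)) => // x [/QX[k _ xk] xt].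
  exists k => // j; rewrite /= mxE; have /andP[-> h] := xk j.
  by case: ifP => // /eqP ->; rewrite le_min xt andbT; have /andP[] := xk i.
- exists (fun k => box_cut_ge i t (Q k)) => // x [/QX[k _ xk] /negP xt].
  exists k => // j; rewrite /= mxE; have /andP[h ->] := xk j; rewrite andbT.
  case: ifP => // /eqP ->; rewrite ge_max; have /andP[-> _] := xk i.
  by rewrite ltW// ltNge.
Qed.

Lemma measurable_box ab : measurable (@box R n.+1 ab : set (Rn R n)).
Proof.
(* The half-spaces at hand are bounded from above, so the lower side a_i <= x_i is expressed as
   avoiding every x_i <= a_i - 1/(k+1). *)
rewrite (_ : box ab = \bigcap_(i in [set: 'I_n.+1])
   ([set x | x 0 i <= ab.2 0 i] `&` ~` \bigcup_k
      [set x | x 0 i <= ab.1 0 i - k.+1%:R^-1])); last first.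
  apply/seteqP; split => [x h i _|x h i] /=.
    have /andP[h1 h2] := h i; split => // -[k _] /= h3.
    have d0 : 0 < k.+1%:R^-1 :> R by [].
    by move: d0 h1 h3; move: (_^-1) => d; lra.
  have [/= -> h2] := h i I; rewrite andbT leNgt; apply/negP => h3; apply: h2.
  have h4 : 0 < ab.1 0 i - x 0 i by rewrite subr_gt0.
  exists (Num.truncn (ab.1 0 i - x 0 i)^-1) => //=.
  rewrite lerBrDr -lerBrDl invf_ple ?posrE//.
  by rewrite ltW// truncnS_gt.
apply: fin_bigcap_measurable => // i _; apply: measurableI.
  exact: measurable_halfspace.
apply: measurableC; apply: bigcupT_measurable => k.
exact: measurable_halfspace.
Qed.

(** An open set is the union of the cubes with rational centre and half-side 1/(k+1) that it
    contains, and there are countably many of them. *)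
Lemma measurable_open A : open A -> measurable (A : set (Rn R n)).
Proof.
move=> oA.
pose B (qk : 'rV[rat]_n.+1 * nat) : 'rV[R]_n.+1 * 'rV[R]_n.+1 :=
  (\row_i (ratr (qk.1 0 i) - qk.2.+1%:R^-1), \row_i (ratr (qk.1 0 i) + qk.2.+1%:R^-1)).
rewrite (_ : A = \bigcup_qk (if `[< box (B qk) `<=` A >] then box (B qk) else set0)).
  apply: countable_bigcupT_measurable; first exact: countableP.
  move=> qk; case: asboolP => _; last exact: measurable0.
  exact: measurable_box.
apply/seteqP; split => [x Ax|x [qk _]]; last first.
  by case: asboolP => // h; exact: h.
have /nbhs_ballP[e /= e0 eA] : nbhs x A by exact: open_nbhs_nbhs.
(* The factor 2: the centre is chosen within d = 1/(k+1) of x in each coordinate, so the cube of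
   half-side d stays within 2d of x. *)
have [k ke] : exists k, k.+1%:R^-1 * 2 < e.
  exists (Num.truncn (2 / e)).
  by rewrite mulrC ltr_pdivrMr// -ltr_pdivrMl// mulrC truncnS_gt.
have : 0 < k.+1%:R^-1 :> R by [].
move dE : k.+1%:R^-1 ke => d ke d0.
have /choice[q xq] : forall i, exists q : rat, `|x 0 i - ratr q| < d.
  move=> i; have := @rat_in_itvoo R (x 0 i - d) (x 0 i + d).
  move=> /(_ _)[|q]; first by lra.
  rewrite in_itv/= => qi; exists q; rewrite ltr_distl; lra.
exists (\row_i q i, k) => //.
case: asboolP => [_|[]] /=.
  move=> i; rewrite /= !mxE dE; have := xq i; rewrite ltr_distl; lra.
move=> y yB; apply: eA; split => // i j; rewrite ord1 /ball/=.
have := yB j; rewrite /= !mxE dE => yj; have := xq j; rewrite ltr_distl => xj.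
rewrite ltr_distl; lra.
Qed.

End boxes.

(** * Integrals under affine maps *)

(** No [+?] hypothesis: [+oo - +oo] and [-oo - -oo] are both [-oo], which is
    fixed by multiplication by [k]. *)
Lemma pmuleBr {R : realType} (k : R) (a b : \bar R) : 0 < k ->
  (k%:E * (a - b) = k%:E * a - k%:E * b)%E.
Proof.
move=> k0; case: a b => [a| |] [b| |] //=;
  rewrite ?gt0_muley ?gt0_muleNy ?lte_fin//=.
by rewrite -EFinB -!EFinM -EFinB mulrBr.
Qed.

Section affine_maps.
Context {R : realType} {n : nat}.
Implicit Types (A D X : set 'rV[R]_n.+1) (z : 'rV[R]_n.+1) (r : R).

Definition aff z r (x : 'rV[R]_n.+1) : 'rV[R]_n.+1 := z + r *: x.

(** Written as an [aff] itself, so that every lemma about [aff] serves for the inverse as well. *)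
Definition aff_inv z r : 'rV[R]_n.+1 -> 'rV[R]_n.+1 := aff (- (r^-1 *: z)) r^-1.

Lemma affK z r : r != 0 -> cancel (aff z r) (aff_inv z r).
Proof.
move=> r0 x; rewrite /aff_inv /aff scalerDr scalerA mulVf// scale1r.
by rewrite addrA addNr add0r.
Qed.

Lemma aff_invK z r : r != 0 -> cancel (aff_inv z r) (aff z r).
Proof.
move=> r0 x; rewrite /aff_inv /aff scalerDr scalerN !scalerA mulfV// !scale1r.
by rewrite addrA subrr add0r.
Qed.

Lemma preimage_aff_inv z r A : r != 0 ->
  aff_inv z r @^-1` (aff z r @^-1` A) = A.
Proof. by move=> r0; apply/seteqP; split=> x /=; rewrite aff_invK. Qed.

(** The inverse map sends the boxes of a cover of [A] to boxes covering the preimage and divides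
    each of the N sides by r; positivity of r keeps the endpoints in order. *)
Lemma lebesgue_outer_preimage_aff_le z r A : 0 < r ->
  (lebesgue_outer (aff z r @^-1` A) <= (r^-1 ^+ n.+1)%:E * lebesgue_outer A)%E.
Proof.
move=> r0; rewrite muleC -lee_pdivrMr ?exprn_gt0 ?invr_gt0//.
apply: le_ereal_inf_tmp => _ [Q QA <-].
rewrite lee_pdivrMr ?exprn_gt0 ?invr_gt0// muleC -nneseriesZl; last first.
  by move=> *; rewrite lee_fin box_volume_ge0.
apply: ereal_inf_lbound.
exists (fun k => (aff_inv z r (Q k).1, aff_inv z r (Q k).2)).
  move=> x /QA[k _ xk]; exists k => // i; have := xk i.
  rewrite /= /aff_inv /aff !mxE => /andP[h1 h2]; apply/andP; split.
    by rewrite addrC -mulrBr mulrC ler_pdivrMr// mulrC lerBlDl.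
  by rewrite addrC -mulrBr mulrC ler_pdivlMr// mulrC lerBrDl.
apply: eq_eseriesr => k _; rewrite -EFinM; congr EFin.
have -> : r^-1 ^+ n.+1 = \prod_(i < n.+1) r^-1 by rewrite prodr_const card_ord.
rewrite /box_volume -big_split/=; apply: eq_bigr => i _.
rewrite /aff_inv /aff !mxE maxr_pMr ?invr_ge0 ?ltW// mulr0.
by congr Num.max; ring.
Qed.

(** The missing inequality is the previous one for the inverse map. *)
Lemma lebesgue_outer_preimage_aff z r A : 0 < r ->
  lebesgue_outer (aff z r @^-1` A) = ((r^-1 ^+ n.+1)%:E * lebesgue_outer A)%E.
Proof.
move=> r0; apply/eqP; rewrite eq_le lebesgue_outer_preimage_aff_le//=.
have k0 : 0 < r^-1 ^+ n.+1 by rewrite exprn_gt0 ?invr_gt0.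
rewrite muleC -lee_pdivlMr// muleC -exprVn.
rewrite -[A in leLHS](@preimage_aff_inv z r) ?gt_eqF//.
by apply: lebesgue_outer_preimage_aff_le; rewrite invr_gt0.
Qed.

(** Every test set X is itself a preimage, and outer measures of preimages all carry the same
    factor, so the Caratheodory identity for [A] transfers. *)
Lemma measurable_preimage_aff z r A : 0 < r ->
  measurable (A : set (Rn R n)) -> measurable (aff z r @^-1` A : set (Rn R n)).
Proof.
move=> r0 mA.
suff : (lebesgue_outer_measure R n).-caratheodory (aff z r @^-1` A) by [].
move=> X.
have r'0 : r^-1 != 0 by rewrite invr_eq0 gt_eqF.
have ->: X = aff z r @^-1` (aff_inv z r @^-1` X).
  by apply/seteqP; split=> x /=; rewrite affK ?gt_eqF.
rewrite preimage_setC -!preimage_setI.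
have h B : lebesgue_outer_measure R n (aff z r @^-1` B) =
  ((r^-1 ^+ n.+1)%:E * lebesgue_outer_measure R n B)%E.
  exact: lebesgue_outer_preimage_aff.
rewrite 3!h -ge0_muleDr ?outer_measure_ge0//; congr (_ * _)%E.
exact: mA.
Qed.

Lemma measurable_fun_aff z r : 0 < r ->
  measurable_fun setT (aff z r : Rn R n -> Rn R n).
Proof. by move=> r0 _ A mA; rewrite setTI; exact: measurable_preimage_aff. Qed.

(** On measurable sets the pushforward of [lebesgueN] under [aff z r] is the multiple of [lebesgueN]
    by r^-N. *)
Lemma ge0_integral_aff z r D (f : 'rV[R]_n.+1 -> \bar R) : 0 < r ->
  measurable (D : set (Rn R n)) ->
  @measurable_fun _ _ (Rn R n) (\bar R) D f ->
  (forall x, 0 <= f x)%E ->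
  (\int[@lebesgueN R n]_(x in (aff z r @^-1` D : set (Rn R n))) f (aff z r x) =
  (r^-1 ^+ n.+1)%:E * \int[@lebesgueN R n]_(x in (D : set (Rn R n))) f x)%E.
Proof.
move=> r0 mD mf f0.
have k0 : 0 <= r^-1 ^+ n.+1 by rewrite exprn_ge0 ?invr_ge0 ?ltW.
have := @ge0_integral_pushforward _ _ _ _ R _ (measurable_fun_aff z r r0)
  (@lebesgueN R n) D f mD mf (fun x _ => f0 x).
rewrite /comp => <-.
rewrite -(@ge0_integral_mscale _ _ R (@lebesgueN R n) D mD (NngNum k0) f mf)//.
apply: eq_measure_integral; first exact: measurable_fun_aff.
by move=> mT A mA _; exact: (lebesgue_outer_preimage_aff z r A r0).
Qed.

Lemma int_Rn_aff z r D (f : 'rV[R]_n.+1 -> R) : 0 < r ->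
  measurable (D : set (Rn R n)) ->
  measurable_fun (D : set (Rn R n)) (f : Rn R n -> R) ->
  int_Rn (aff z r @^-1` D) (fun x => f (aff z r x)) =
  ((r^-1 ^+ n.+1)%:E * int_Rn D f)%E.
Proof.
move=> r0 mD mf; rewrite /int_Rn [LHS]integralE [in RHS]integralE.
have mf' : @measurable_fun _ _ (Rn R n) (\bar R) D (EFin \o f).
  exact/measurable_EFinP.
rewrite pmuleBr ?exprn_gt0 ?invr_gt0//; congr (_ - _)%E.
- rewrite -(ge0_integral_aff z r D (fun x => (f x)%:E)^\+%E r0 mD)//;
    first by apply: eq_integral => x _; rewrite !funeposE.
  exact: measurable_funepos mf'.
- rewrite -(ge0_integral_aff z r D (fun x => (f x)%:E)^\-%E r0 mD)//;
    first by apply: eq_integral => x _; rewrite !funenegE.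
  exact: measurable_funeneg mf'.
Qed.

End affine_maps.

(** * Sobolev spaces and the functional under affine maps *)

Lemma is_diff_affine (R : realType) (V : normedModType R) (z : V) (r : R) (x : V) :
  is_diff x (fun x => z + r *: x) (fun h => r *: h).
Proof.
have h : is_diff x (cst z + r *: id) (0 + r *: id) by apply: is_diffD.
by apply: (is_diff_eq h); apply/funext => y; rewrite add0r.
Qed.

Section affine_calculus.
Context {R : realType} {n : nat}.
Implicit Types (A D K : set 'rV[R]_n.+1) (z : 'rV[R]_n.+1) (r : R)
  (f : 'rV[R]_n.+1 -> R).

Lemma continuous_aff z r : continuous (aff z r).
Proof. exact: continuous_affine. Qed.

Lemma gradE f x i : differentiable f x -> grad f x 0 i = 'd f x (delta_mx 0 i).
Proof. by move=> df; rewrite mxE deriveE. Qed.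

Lemma diff_dotv_grad f x h : differentiable f x -> 'd f x h = dotv (grad f x) h.
Proof.
move=> df; rewrite [in LHS](row_sum_delta h) linear_sum/=.
by apply: eq_bigr => i _; rewrite linearZ gradE// mulrC.
Qed.

Lemma is_diff_comp_aff c z r f x : differentiable f (aff z r x) ->
  is_diff x (fun x => c * f (aff z r x)) (fun h => c * 'd f (aff z r x) (r *: h)).
Proof.
move=> df; have df' : is_diff (aff z r x) f ('d f (aff z r x)) by exact: DiffDef.
have := @is_diff_comp _ _ _ _ _ _ _ _ _ (is_diff_affine R _ z r x) df'.
move=> /(is_diffZ c); exact.
Qed.

Lemma differentiable_comp_aff c z r f x : differentiable f (aff z r x) ->
  differentiable (fun x => c * f (aff z r x)) x.
Proof. by move=> /(is_diff_comp_aff c)[]. Qed.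

Lemma grad_comp_aff c z r f x : differentiable f (aff z r x) ->
  grad (fun x => c * f (aff z r x)) x = (c * r) *: grad f (aff z r x).
Proof.
move=> df; apply/rowP => i; rewrite gradE; last exact: differentiable_comp_aff.
have ? := is_diff_comp_aff c z r f x df; rewrite diff_val.
by rewrite linearZ/= [RHS]mxE gradE// mulrA.
Qed.

(** The constant [c] is general because each differentiation replaces it by [c * r] in the
    induction. *)
Lemma is_Ck_comp_aff k c z r f : is_Ck k f -> is_Ck k (fun x => c * f (aff z r x)).
Proof.
elim: k f c => [|k IH] f c /=.
  move=> cf x; apply: continuousM; first exact: cst_continuous.
  by apply: continuous_comp; [exact: continuous_aff|exact: cf].
move=> [df gf]; split => [x|i]; first exact: differentiable_comp_aff.
rewrite (_ : (fun x => _) = (fun x => (c * r) * grad f (aff z r x) 0 i)).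
  exact: (IH (fun x => grad f x 0 i)) (gf i).
by apply/funext => x; rewrite grad_comp_aff// mxE.
Qed.

Lemma closed_preimage_aff z r A : closed A -> closed (aff z r @^-1` A).
Proof. by move=> cA; apply: preimage_closed => // x _; exact: continuous_aff. Qed.

Lemma open_preimage_aff z r A : open A -> open (aff z r @^-1` A).
Proof. by move=> cA; apply: open_comp => // x _; exact: continuous_aff. Qed.

Lemma closure_preimage_aff z r A :
  closure (aff z r @^-1` A) `<=` aff z r @^-1` closure A.
Proof.
have /closure_id -> : closed (aff z r @^-1` closure A).
  by apply: closed_preimage_aff; exact: closed_closure.
by apply: closureS => x /= Ax; exact: (@subset_closure _ A).
Qed.

Lemma compact_preimage_aff z r A : r != 0 -> compact A -> compact (aff z r @^-1` A).
Proof.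
move=> r0 cA.
have -> : aff z r @^-1` A = aff_inv z r @` A.
  apply/seteqP; split => [x /= Ax|_ [x Ax <-]/=]; last by rewrite aff_invK.
  by exists (aff z r x) => //; rewrite affK.
apply: continuous_compact => //; apply: continuous_subspaceT.
exact: continuous_aff.
Qed.

Lemma compactly_contained_preimage_aff z r A D : r != 0 ->
  compactly_contained A D ->
  compactly_contained (aff z r @^-1` A) (aff z r @^-1` D).
Proof.
move=> r0 [cA AD]; split => [|x /closure_preimage_aff/=]; last exact: AD.
apply: (subclosed_compact _ (compact_preimage_aff z r (closure A) r0 cA)).
  exact: closed_closure.
exact: closure_preimage_aff.
Qed.

Lemma test_function_comp_aff c z r D f : r != 0 -> test_function D f ->
  test_function (aff z r @^-1` D) (fun x => c * f (aff z r x)).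
Proof.
move=> r0 [fC fD]; split => [k|]; first exact: is_Ck_comp_aff.
have [cK KD] := compactly_contained_preimage_aff z r _ _ r0 fD.
have sub : closure [set x | c * f (aff z r x) != 0] `<=`
    closure (aff z r @^-1` [set x | f x != 0]).
  by apply: closureS => x /=; rewrite mulf_eq0 negb_or => /andP[].
split; last exact: subset_trans sub KD.
by apply: (subclosed_compact _ cK sub); exact: closed_closure.
Qed.

(** A point off [D] lies outside the closed support, so [f] vanishes in a whole neighbourhood of
    it. *)
Lemma test_function_eq0 D f x : test_function D f -> ~ D x ->
  f x = 0 /\ grad f x = 0.
Proof.
move=> [_ [_ fD]] Dx.
have nf : \forall y \near x, f y = 0.
  have : nbhs x (~` closure [set x | f x != 0]).
    apply: open_nbhs_nbhs; split; last by move=> /fD.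
    by apply: closed_openC; exact: closed_closure.
  apply: filterS => y yf; apply/eqP; apply: contrapT => /negP fy; apply: yf.
  exact: subset_closure.
split; first exact: nbhs_singleton nf.
apply/rowP => i; rewrite !mxE.
rewrite (@near_eq_derive _ _ _ _ (cst 0)) ?derive_cst//.
Qed.

Lemma continuous_measurable_Rn f : continuous f ->
  measurable_fun setT (f : Rn R n -> R).
Proof.
move=> cf; apply: (measurability _ (RGenOInfty.measurableE R)) => //.
move=> _ [_ [a ->] <-]; rewrite setTI; apply: measurable_open.
by apply: open_comp => [x _|]; [exact: cf|exact: interval_open].
Qed.

Lemma test_function_continuous D f : test_function D f -> continuous f.
Proof. by move=> [/(_ 0%N)]. Qed.

Lemma test_function_differentiable D f x : test_function D f -> differentiable f x.
Proof. by move=> [/(_ 1%N)[]]. Qed.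

Lemma test_function_continuous_grad D f i : test_function D f ->
  continuous (fun x => grad f x 0 i).
Proof. by move=> [/(_ 1%N)[_ /(_ i)]]. Qed.

Lemma test_function_subset D D' f : D `<=` D' -> test_function D f -> test_function D' f.
Proof.
by move=> DD [h1 [h2 h3]]; split=> //; split=> //; exact: subset_trans DD.
Qed.

End affine_calculus.

Section scaling.
Context {R : realType} {n : nat}.
Implicit Types (A B D K : set 'rV[R]_n.+1) (z : 'rV[R]_n.+1) (r c k p lp lm gam a : R)
  (f g u phi : 'rV[R]_n.+1 -> R) (G H : 'rV[R]_n.+1 -> 'rV[R]_n.+1).

Local Notation mfun D f := (measurable_fun (D : set (Rn R n)) (f : Rn R n -> R)).
Local Notation mset D := (measurable (D : set (Rn R n))).

Lemma eq_int_Rn D f g : (forall x, D x -> f x = g x) -> int_Rn D f = int_Rn D g.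
Proof. by move=> fg; apply: eq_integral => x; rewrite inE => /fg ->. Qed.

Lemma int_Rn_support D D' f : D' `<=` D -> (forall x, ~ D' x -> f x = 0) ->
  int_Rn D f = int_Rn D' f.
Proof.
move=> DD f0; rewrite /int_Rn integral_mkcond [RHS]integral_mkcond.
apply: eq_integral => x _; rewrite !patchE.
have [xD'|xD'] := asboolP (D' x).
  by rewrite !mem_set//; exact: DD.
rewrite [x \in D']memNset//; case: ifP => // _; by rewrite f0.
Qed.

Lemma int_RnZ c D f : 0 < c -> mset D -> mfun D f ->
  int_Rn D (fun x => c * f x) = (c%:E * int_Rn D f)%E.
Proof.
move=> c0 mD mf; rewrite /int_Rn [LHS]integralE [in RHS]integralE pmuleBr//.
have mf' : @measurable_fun _ _ (Rn R n) (\bar R) D (EFin \o f).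
  exact/measurable_EFinP.
congr (_ - _)%E.
- rewrite -(@ge0_integralZl_EFin _ _ _ (@lebesgueN R n) D mD (fun x => (f x)%:E)^\+%E) ?ltW//.
  + by apply: eq_integral => x _; rewrite !funeposE EFinM maxe_pMr ?mule0// lee_fin ltW.
  + exact: measurable_funepos.
- rewrite -(@ge0_integralZl_EFin _ _ _ (@lebesgueN R n) D mD (fun x => (f x)%:E)^\-%E) ?ltW//.
  + by apply: eq_integral => x _; rewrite !funenegE EFinM -muleN
      maxe_pMr ?mule0// lee_fin ltW.
  + exact: measurable_funeneg.
Qed.

Lemma measurable_fun_comp_aff z r D f : 0 < r -> mset D -> mfun D f ->
  mfun (aff z r @^-1` D) (fun x => f (aff z r x)).
Proof.
move=> r0 mD mf; apply: (@measurable_comp _ _ _ _ _ _ (D : set (Rn R n))) => //.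
  by move=> _ [x Dx <-].
apply: measurable_funTS; exact: measurable_fun_aff.
Qed.

Lemma int_Rn_affZ c z r D f : 0 < r -> 0 < c -> mset D -> mfun D f ->
  int_Rn (aff z r @^-1` D) (fun x => c * f (aff z r x)) =
  ((c * r^-1 ^+ n.+1)%:E * int_Rn D f)%E.
Proof.
move=> r0 c0 mD mf.
rewrite (int_RnZ c _ _ c0 (measurable_preimage_aff z r D r0 mD)
  (measurable_fun_comp_aff z r D f r0 mD mf)).
by rewrite (int_Rn_aff z r D f r0 mD mf) muleA EFinM.
Qed.

Lemma measurable_fun_enorm D G : mset D -> (forall i, mfun D (fun x => G x 0 i)) ->
  mfun D (fun x => enorm (G x)).
Proof.
move=> mD mG; rewrite /enorm.
apply: (@measurableT_comp _ _ _ _ _ _ (@Num.sqrt R)).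
  by apply: continuous_measurable_fun; exact: sqrt_continuous.
by apply: measurable_sum => i; exact: measurable_funM.
Qed.

Lemma measurable_fun_powR_norm p D f : mfun D f -> mfun D (fun x => `|f x| `^ p).
Proof.
move=> mf; apply: (@measurableT_comp _ _ _ _ _ _ (fun x : R => x `^ p)).
  exact: measurable_powR.
exact: measurableT_comp.
Qed.

Lemma int_Rn_ge0 D f : (forall x, 0 <= f x) -> (0 <= int_Rn D f)%E.
Proof. by move=> f0; apply: integral_ge0 => x _; rewrite lee_fin. Qed.

Lemma ge0_int_Rn_subset B D f : mset B -> mset D -> B `<=` D -> mfun D f ->
  (forall x, 0 <= f x) -> (int_Rn B f <= int_Rn D f)%E.
Proof.
move=> mB mD BD mf f0.
have f0' x : D x -> (0 <= (f x)%:E)%E by rewrite lee_fin.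
have mf' : @measurable_fun _ _ (Rn R n) (\bar R) D (EFin \o f).
  exact/measurable_EFinP.
exact: (ge0_subset_integral (@lebesgueN R n) mB mD mf' f0' BD).
Qed.

Lemma in_Lp_subset p B D f : mset B -> mset D -> B `<=` D ->
  in_Lp p D f -> in_Lp p B f.
Proof.
move=> mB mD BD [mf f_fin]; split; first exact: measurable_funS mf.
apply: le_lt_trans f_fin.
have p0 x : 0 <= `|f x| `^ p by exact: powR_ge0.
exact: (ge0_int_Rn_subset _ _ _ mB mD BD (measurable_fun_powR_norm p D f mf) p0).
Qed.

Lemma in_Lp_comp_aff p c z r D f : 0 < r -> 0 < c -> mset D ->
  in_Lp p D f -> in_Lp p (aff z r @^-1` D) (fun x => c * f (aff z r x)).
Proof.
move=> r0 c0 mD [mf f_fin]; split.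
  apply: measurable_funM; first exact: measurable_cst.
  exact: measurable_fun_comp_aff.
rewrite (@eq_int_Rn _ _ (fun x => c `^ p * (`|f (aff z r x)| `^ p))); last first.
  by move=> x _; rewrite normrM powRM// gtr0_norm.
rewrite (int_Rn_affZ _ _ _ _ _ r0 (powR_gt0 p c0) mD (measurable_fun_powR_norm p D f mf)).
by rewrite lte_mul_pinfty// lee_fin mulr_ge0 ?powR_ge0// exprn_ge0// invr_ge0 ltW.
Qed.

Lemma weak_gradient_subset B D u G : B `<=` D ->
  weak_gradient D u G -> weak_gradient B u G.
Proof.
move=> BD wD phi tphi i.
have := wD phi (test_function_subset _ _ _ BD tphi) i.
by rewrite !(int_Rn_support D B) => // x /(test_function_eq0 _ _ _ tphi)[h1 h2];
  rewrite ?h1 ?h2 ?mxE ?mulr0.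
Qed.

(** A test function phi on the preimage is psi composed with [aff z r], for a test function psi on
    [D]. The relation grad phi = r grad psi supplies the additional factor r of the new gradient. *)
Lemma weak_gradient_comp_aff k z r D u G : 0 < r -> 0 < k -> mset D ->
  mfun D u -> (forall i, mfun D (fun x => G x 0 i)) ->
  weak_gradient D u G ->
  weak_gradient (aff z r @^-1` D) (fun x => k * u (aff z r x))
    (fun x => (k * r) *: G (aff z r x)).
Proof.
move=> r0 k0 mD mu mG wD phi tphi i.
have r1 : r != 0 by rewrite gt_eqF.
have kr0 : 0 < k * r by exact: mulr_gt0.
(* The factor 1 gives [psi] the form treated by [test_function_comp_aff]. *)
pose psi y := 1 * phi (aff_inv z r y).
have tpsi : test_function D psi.
  rewrite -[D](preimage_aff_inv z r)//; apply: test_function_comp_aff => //.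
  by rewrite invr_eq0.
have phiE x : phi x = psi (aff z r x) by rewrite /psi mul1r affK.
have dphiE x : grad phi x = r *: grad psi (aff z r x).
  have := grad_comp_aff 1 z r psi x (test_function_differentiable _ _ _ tpsi).
  rewrite mul1r => <-.
  by congr (grad _ x); apply/funext => y; rewrite mul1r phiE.
have mpsi : mfun D psi.
  apply: measurable_funTS; apply: continuous_measurable_Rn.
  exact: test_function_continuous tpsi.
have mdpsi : mfun D (fun x => grad psi x 0 i).
  apply: measurable_funTS; apply: continuous_measurable_Rn.
  exact: test_function_continuous_grad tpsi.
rewrite (@eq_int_Rn _ _ (fun x => (k * r) * ((fun y => u y * grad psi y 0 i) (aff z r x)))).
  rewrite (int_Rn_affZ _ _ _ _ _ r0 kr0 mD (measurable_funM mu mdpsi)).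
  rewrite (wD _ tpsi) muleN; congr (- _)%E.
  rewrite -(int_Rn_affZ _ z _ _ _ r0 kr0 mD (measurable_funM (mG i) mpsi)).
  by apply: eq_int_Rn => x _; rewrite phiE mxE mulrA.
by move=> x _ /=; rewrite dphiE mxE; ring.
Qed.

Lemma W1p_subset p B D u G : mset B -> mset D -> B `<=` D ->
  W1p p D u G -> W1p p B u G.
Proof.
move=> mB mD BD [uLp GLp wD]; split; first exact: in_Lp_subset mB mD BD uLp.
  by move=> i; exact: in_Lp_subset mB mD BD (GLp i).
exact: weak_gradient_subset wD.
Qed.

Lemma W1p_comp_aff p k z r D u G : 0 < r -> 0 < k -> mset D ->
  W1p p D u G -> W1p p (aff z r @^-1` D) (fun x => k * u (aff z r x))
    (fun x => (k * r) *: G (aff z r x)).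
Proof.
move=> r0 k0 mD [uLp GLp wD]; split; first exact: in_Lp_comp_aff.
  move=> i; under eq_fun do rewrite mxE.
  exact: (in_Lp_comp_aff _ _ _ _ _ (fun x => G x 0 i) r0 (mulr_gt0 k0 r0) mD (GLp i)).
exact: (weak_gradient_comp_aff _ _ _ _ _ _ r0 k0 mD uLp.1 (fun i => (GLp i).1) wD).
Qed.

Lemma cvg_int_Rn_comp_aff c z r D (f : nat -> 'rV[R]_n.+1 -> R) :
  0 < r -> 0 < c -> mset D -> (forall j, mfun D (f j)) ->
  (fun j => int_Rn D (f j)) @ \oo --> 0%E ->
  (fun j => int_Rn (aff z r @^-1` D) (fun x => c * f j (aff z r x))) @ \oo --> 0%E.
Proof.
move=> r0 c0 mD mf f0; under eq_fun do rewrite (int_Rn_affZ _ _ _ _ _ r0 c0 mD (mf _)).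
have fin : (c * r^-1 ^+ n.+1)%:E \is a fin_num by [].
by have := cvgeZl fin f0; rewrite mule0.
Qed.

(** The approximating test functions are rescaled along with [phi]: the errors in the function and
    in the gradient are multiplied by k^p r^-N and (k r)^p r^-N, so they still tend to 0. *)
Lemma W1p0_comp_aff p k z r D phi H : 0 < r -> 0 < k -> mset D ->
  W1p0 p D phi H -> W1p0 p (aff z r @^-1` D) (fun x => k * phi (aff z r x))
    (fun x => (k * r) *: H (aff z r x)).
Proof.
move=> r0 k0 mD [WD phi0 [f [tf fphi dfH]]].
have r1 : r != 0 by rewrite gt_eqF.
have kr0 : 0 < k * r by exact: mulr_gt0.
have [[mphi _] HLp _] := WD.
split; first exact: W1p_comp_aff.
  by move=> x /= /phi0[-> ->]; rewrite mulr0 scaler0.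
exists (fun j x => k * f j (aff z r x)); split.
- by move=> j; exact: test_function_comp_aff.
- rewrite (_ : (fun j => _) = (fun j => int_Rn (aff z r @^-1` D)
    (fun x => k `^ p * (fun y => `|f j y - phi y| `^ p) (aff z r x)))); last first.
    apply/funext => j; apply: eq_int_Rn => x _.
    by rewrite -mulrBr normrM powRM// gtr0_norm.
  apply: (cvg_int_Rn_comp_aff _ _ _ _ (fun j y => `|f j y - phi y| `^ p)
    r0 (powR_gt0 p k0) mD _ fphi).
  move=> j; apply: measurable_fun_powR_norm; apply: measurable_funB mphi.
  apply: measurable_funTS; apply: continuous_measurable_Rn.
  exact: test_function_continuous (tf j).
- rewrite (_ : (fun j => _) = (fun j => int_Rn (aff z r @^-1` D)
    (fun x => (k * r) `^ p *
      (fun y => enorm (grad (f j) y - H y) `^ p) (aff z r x)))); last first.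
    apply/funext => j; apply: eq_int_Rn => x _.
    rewrite grad_comp_aff; last exact: test_function_differentiable (tf j).
    by rewrite -scalerBr enormZ (gtr0_norm kr0) [LHS]powRM ?enorm_ge0// ltW.
  apply: (cvg_int_Rn_comp_aff _ _ _ _ (fun j y => enorm (grad (f j) y - H y) `^ p)
    r0 (powR_gt0 p kr0) mD _ dfH).
  move=> j.
  apply: (@measurableT_comp _ _ _ _ _ _ (fun x : R => x `^ p)).
    exact: measurable_powR.
  apply: (measurable_fun_enorm _ _ mD) => i; under eq_fun do rewrite !mxE.
  apply: measurable_funB; last by case: (HLp i).
  have := test_function_continuous_grad _ _ i (tf j); under eq_fun do rewrite mxE.
  by move=> /continuous_measurable_Rn; exact: measurable_funTS.
Qed.

(** * The energy: scaling, finiteness and localization *)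

Definition density (p lp lm gam : R) u G x : R :=
  enorm (G x) `^ p / p + (lp * (u^\+ x) `^ gam + lm * (u^\- x) `^ gam).

Lemma density_ge0 p lp lm gam u G x : 0 < p -> 0 < lp -> 0 < lm ->
  0 <= density p lp lm gam u G x.
Proof.
by move=> p0 lp0 lm0; rewrite !addr_ge0// ?divr_ge0 ?mulr_ge0 ?powR_ge0 ?ltW.
Qed.

Lemma measurable_density p lp lm gam u G D : mset D -> mfun D u ->
  (forall i, mfun D (fun x => G x 0 i)) -> mfun D (density p lp lm gam u G).
Proof.
move=> mD mu mG.
have mpow q f : mfun D f -> mfun D (fun x => f x `^ q).
  by apply: (@measurableT_comp _ _ _ _ _ _ (fun x : R => x `^ q)); exact: measurable_powR.
have mcst c : mfun D (fun=> c) by exact: measurable_cst.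
apply: measurable_funD; first apply: measurable_funM (mcst _).
  apply: mpow; exact: measurable_fun_enorm.
apply: measurable_funD; apply: measurable_funM (mcst _) _; apply: mpow.
  exact: measurable_funrpos.
exact: measurable_funrneg.
Qed.

(** The gradient term scales by (k r)^p and the potential terms by k^gam; the assumption on k and r
    makes these factors agree. *)
Lemma density_comp_aff p lp lm gam k z r u G x : 0 < r -> 0 < k ->
  (k * r) `^ p = k `^ gam ->
  density p lp lm gam (fun x => k * u (aff z r x)) (fun x => (k * r) *: G (aff z r x)) x =
  k `^ gam * density p lp lm gam u G (aff z r x).
Proof.
move=> r0 k0 kr; have kr0 : 0 < k * r by exact: mulr_gt0.
rewrite /density enormZ (gtr0_norm kr0) [(k * r * _) `^ p]powRM ?enorm_ge0 ?(ltW kr0)//.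
rewrite kr.
have -> : (fun x => k * u (aff z r x))^\+ x = k * u^\+ (aff z r x).
  by rewrite /funrpos maxr_pMr ?ltW// mulr0.
have -> : (fun x => k * u (aff z r x))^\- x = k * u^\- (aff z r x).
  by rewrite /funrneg -mulrN maxr_pMr ?ltW// mulr0.
rewrite !(powRM _ (ltW k0)) ?funrpos_ge0 ?funrneg_ge0//.
ring.
Qed.

Lemma lebesgue_outer_bounded_lty A : bounded_set A -> (lebesgue_outer A < +oo)%E.
Proof.
move=> [M [_ AM0]]; pose m := M + 1.
have AM x : A x -> `|x| <= m by move=> Ax; apply: AM0 Ax; rewrite ltrDl.
(* One cube covers [A]; the cover is padded with degenerate boxes, of volume 0 because N >= 1. *)
pose Q (k : nat) : 'rV[R]_n.+1 * 'rV[R]_n.+1 :=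
  if k is 0 then (const_mx (- m), const_mx m) else (0, 0).
apply: (@le_lt_trans _ _ (\sum_(k <oo) (box_volume (Q k))%:E)%E).
  apply: ereal_inf_lbound; exists Q => // x /AM xm; exists 0%N => // i.
  rewrite /= !mxE -ler_norml; apply: le_trans xm.
  rewrite [leRHS]/Num.norm/= mx_normrE.
  exact: (le_bigmax _ (fun ij : 'I_1 * 'I_n.+1 => `|x ij.1 ij.2|) (0, i)).
rewrite nneseries_recl//; last by move=> k _; rewrite lee_fin box_volume_ge0.
rewrite [X in (_ + X)%E]eseries0 ?adde0 ?ltry// => -[|k] // _ _.
by rewrite /box_volume/= big_ord_recl /= subrr maxxx mul0r.
Qed.

(** The length is at most N times the largest entry, whose p-th power is one term of the sum. This
    reduces integrability of |G|^p to that of the coordinates of [G]. *)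
Lemma enorm_powR_le p (x : 'rV[R]_n.+1) : 0 < p ->
  enorm x `^ p <= n.+1%:R `^ p * \sum_i `|x 0 i| `^ p.
Proof.
move=> p0.
have [i _ imax] := @arg_maxP _ _ _ (ord0 : 'I_n.+1) xpredT (fun i => `|x 0 i|) isT.
apply: (@le_trans _ _ ((n.+1%:R * `|x 0 i|) `^ p)).
  apply: (ge0_ler_powR (ltW p0)); rewrite ?nnegrE ?enorm_ge0 ?mulr_ge0//.
  rewrite -ler_sqr ?nnegrE ?enorm_ge0 ?mulr_ge0// sqr_enorm.
  apply: (@le_trans _ _ (\sum_(j < n.+1) `|x 0 i| ^+ 2)).
    apply: ler_sum => j _; rewrite -expr2 -(real_normK (num_real _)).
    by rewrite ler_sqr ?nnegrE//; exact: imax.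
  rewrite sumr_const card_ord -[leLHS]mulr_natl exprMn ler_wpM2r ?sqr_ge0//.
  by rewrite -natrX ler_nat leq_pmulr.
rewrite powRM// ler_wpM2l ?powR_ge0//.
rewrite (bigD1 i)//= lerDl; apply: sumr_ge0 => j _; exact: powR_ge0.
Qed.

Lemma int_RnD D f g : mset D -> mfun D f -> mfun D g ->
  (forall x, 0 <= f x) -> (forall x, 0 <= g x) ->
  int_Rn D (fun x => f x + g x) = (int_Rn D f + int_Rn D g)%E.
Proof.
move=> mD mf mg f0 g0.
have mf' : @measurable_fun _ _ (Rn R n) (\bar R) D (EFin \o f).
  exact/measurable_EFinP.
have mg' : @measurable_fun _ _ (Rn R n) (\bar R) D (EFin \o g).
  exact/measurable_EFinP.
rewrite /int_Rn -(@ge0_integralD _ _ _ (@lebesgueN R n) D mD _ _ _ mf' _ mg').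
- by apply: eq_integral => x _; rewrite EFinD.
- by move=> x _; rewrite lee_fin.
- by move=> x _; rewrite lee_fin.
Qed.

Lemma int_Rn_sum_lty D (I : Type) (s : seq I) (f : I -> 'rV[R]_n.+1 -> R) :
  mset D -> (forall i, mfun D (f i)) -> (forall i x, 0 <= f i x) ->
  (forall i, int_Rn D (f i) < +oo)%E ->
  (int_Rn D (fun x => \sum_(i <- s) f i x)%R < +oo)%E.
Proof.
move=> mD mf f0 ff; elim: s => [|i s IH].
  rewrite (@eq_int_Rn _ _ (fun=> 0)) => [|x _]; last by rewrite big_nil.
  by rewrite /int_Rn integral0.
have mS : mfun D (fun x => \sum_(j <- s) f j x) by exact: measurable_sum.
have S0 x : 0 <= \sum_(j <- s) f j x by apply: sumr_ge0 => j _; exact: f0.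
under eq_fun do rewrite big_cons.
rewrite (int_RnD _ _ _ mD (mf i) mS (f0 i) S0).
exact: lte_add_pinfty (ff i) IH.
Qed.

Lemma ge0_le_int_Rn D f g : mset D -> mfun D f -> mfun D g ->
  (forall x, 0 <= f x) -> (forall x, f x <= g x) ->
  (int_Rn D f <= int_Rn D g)%E.
Proof.
move=> mD mf mg f0 fg.
have mf' : @measurable_fun _ _ (Rn R n) (\bar R) D (EFin \o f).
  exact/measurable_EFinP.
have mg' : @measurable_fun _ _ (Rn R n) (\bar R) D (EFin \o g).
  exact/measurable_EFinP.
apply: (@ge0_le_integral _ _ _ (@lebesgueN R n) D mD _ _ _ mf' mg').
- by move=> x _; rewrite lee_fin.
- by move=> x _; rewrite lee_fin.
Qed.

(** The potential terms are controlled by t^gam <= 1 + t^p, whose constant is integrable because a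
    bounded set has finite measure. *)
Lemma functionalJ_lty p lp lm gam D u G : 1 < p -> 0 < lp -> 0 < lm ->
  0 < gam < p -> open D -> bounded_set D ->
  W1p p D u G -> (functionalJ p lp lm gam D u G < +oo)%E.
Proof.
move=> p1 lp0 lm0 /andP[gam0 gamp] oD bD [[mu ufin] GLp _].
have p0 : 0 < p by exact: lt_trans p1.
have mD : mset D by exact: measurable_open.
have mcst c : mfun D (fun=> c) by exact: measurable_cst.
pose f1 x := n.+1%:R `^ p / p * \sum_i `|G x 0 i| `^ p.
pose f2 x := (lp + lm) * (1 + `|u x| `^ p).
have c1 : 0 < n.+1%:R `^ p / p by rewrite divr_gt0// powR_gt0.
have c2 : 0 < lp + lm by rewrite addr_gt0.
have mG i : mfun D (fun x => `|G x 0 i| `^ p).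
  by apply: measurable_fun_powR_norm; case: (GLp i).
have mu' := measurable_fun_powR_norm p D u mu.
have mS : mfun D (fun x => \sum_i `|G x 0 i| `^ p) by exact: measurable_sum.
have mu1 : mfun D (fun x => 1 + `|u x| `^ p) by exact: measurable_funD (mcst _) mu'.
have m1 : mfun D f1 by exact: measurable_funM (mcst _) mS.
have m2 : mfun D f2 by exact: measurable_funM (mcst _) mu1.
have f10 x : 0 <= f1 x.
  by rewrite mulr_ge0 ?(ltW c1)//; apply: sumr_ge0 => i _; exact: powR_ge0.
have f20 x : 0 <= f2 x by rewrite mulr_ge0 ?(ltW c2)// addr_ge0// powR_ge0.
have md : mfun D (density p lp lm gam u G).
  exact: (measurable_density _ _ _ _ _ _ _ mD mu (fun i => (GLp i).1)).
apply: (@le_lt_trans _ _ (int_Rn D (fun x => f1 x + f2 x))).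
  have d0 x := density_ge0 p lp lm gam u G x p0 lp0 lm0.
  apply: (ge0_le_int_Rn _ _ _ mD md (measurable_funD m1 m2) d0) => x.
  apply: lerD.
    rewrite /f1 mulrAC ler_wpM2r ?invr_ge0 ?(ltW p0)//; exact: enorm_powR_le.
  have upow (w : R) : 0 <= w -> w <= `|u x| -> w `^ gam <= 1 + `|u x| `^ p.
    move=> w0 wu; apply: (@le_trans _ _ (`|u x| `^ gam)).
      by apply: (ge0_ler_powR (ltW gam0)); rewrite ?nnegrE.
    have [u1|u1] := leP 1 `|u x|.
      by rewrite -[leLHS]add0r lerD// ler_powR// ltW.
    rewrite -[leLHS]addr0 lerD ?powR_ge0//.
    rewrite (_ : 1 = 1 `^ gam); last by rewrite powR1.
    by apply: (ge0_ler_powR (ltW gam0)); rewrite ?nnegrE//; exact: ltW.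
  rewrite /f2 mulrDl; apply: lerD; rewrite ler_pM2l//; apply: upow.
  - exact: funrpos_ge0.
  - by rewrite /funrpos ge_max ler_norm normr_ge0.
  - exact: funrneg_ge0.
  - by rewrite /funrneg ge_max -normrN ler_norm normr_ge0.
rewrite (int_RnD _ _ _ mD m1 m2 f10 f20); apply: lte_add_pinfty.
  rewrite (int_RnZ _ _ _ c1 mD mS); apply: lte_mul_pinfty => //.
    by rewrite lee_fin (ltW c1).
  apply: (int_Rn_sum_lty _ _ _ _ mD mG) => [i x|i]; first exact: powR_ge0.
  by case: (GLp i).
have u0 x : 0 <= `|u x| `^ p by exact: powR_ge0.
rewrite (int_RnZ _ _ _ c2 mD mu1); apply: lte_mul_pinfty => //.
  by rewrite lee_fin (ltW c2).
rewrite (int_RnD D (fun=> 1) (fun x => `|u x| `^ p) mD (mcst 1) mu' (fun=> ler01) u0).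
apply: lte_add_pinfty ufin.
rewrite /int_Rn integral_cst// mul1e; exact: lebesgue_outer_bounded_lty.
Qed.

(** Both integrals over [D] contain the same contribution of the complement of [B]. It is finite,
    being at most the integral of [f], and so can be cancelled. *)
Lemma int_Rn_localize B D f g : mset B -> mset D -> B `<=` D ->
  mfun D f -> mfun D g -> (forall x, 0 <= f x) -> (forall x, 0 <= g x) ->
  (forall x, ~ B x -> f x = g x) ->
  (int_Rn D f < +oo)%E -> (int_Rn D f <= int_Rn D g)%E ->
  (int_Rn B f <= int_Rn B g)%E.
Proof.
move=> mB mD BD mf mg f0 g0 fg ffin fgD.
have mDB : mset (D `\` B) by exact: measurableD.
have split_int h : mfun D h -> (forall x, 0 <= h x) ->
    int_Rn D h = (int_Rn B h + int_Rn (D `\` B) h)%E.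
  move=> mh h0.
  have E : B `|` (D `\` B) = D by rewrite setDUK.
  rewrite -[in LHS]E; apply: (ge0_integral_setU (@lebesgueN R n) mB mDB).
  - by rewrite E; exact/measurable_EFinP.
  - by move=> x _; rewrite lee_fin.
  - by apply/disj_setPS => x [Bx []].
move: ffin fgD; rewrite !split_int// (eq_int_Rn (D `\` B) f g); last first.
  by move=> x [_ /fg].
move=> ffin; rewrite leeD2rE// ge0_fin_numE ?int_Rn_ge0//.
apply: le_lt_trans ffin; rewrite leeDr// int_Rn_ge0//.
Qed.

Lemma measurable_fun_zero_ext E D f : mset E -> mset D -> mfun E f ->
  (forall x, ~ E x -> f x = 0) -> mfun D f.
Proof.
move=> mE mD mf f0; apply: measurable_funTS.
rewrite (_ : f = (f : Rn R n -> R) \_ (E : set (Rn R n))).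
  exact/(measurable_restrictT _ mE).
apply/funext => x; rewrite patchE; case: ifPn => // /negP xE.
by apply: f0 => Ex; apply: xE; rewrite inE.
Qed.

Lemma functionalJ_comp_aff p lp lm gam k z r D u G : 0 < r -> 0 < k ->
  (k * r) `^ p = k `^ gam -> mset D -> mfun D u ->
  (forall i, mfun D (fun x => G x 0 i)) ->
  functionalJ p lp lm gam (aff z r @^-1` D) (fun x => k * u (aff z r x))
    (fun x => (k * r) *: G (aff z r x)) =
  ((k `^ gam * r^-1 ^+ n.+1)%:E * functionalJ p lp lm gam D u G)%E.
Proof.
move=> r0 k0 kr mD mu mG.
rewrite -[functionalJ _ _ _ _ D u G]/(int_Rn D (density p lp lm gam u G)).
rewrite -(int_Rn_affZ _ z _ _ _ r0 (powR_gt0 gam k0) mD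
  (measurable_density p lp lm gam _ _ _ mD mu mG)).
by apply: eq_int_Rn => x _; exact: density_comp_aff.
Qed.

(** A competitor for the rescaled function is scaled back to a perturbation psi of [u] supported
    inside [B]. Minimality of [u] over [D] is then localized to [B], and scaling multiplies both
    energies over [B] by the same positive factor. *)
Lemma local_minimizer_comp_aff p lp lm gam k z r D B u :
  1 < p -> 0 < lp -> 0 < lm -> 0 < gam < p ->
  0 < r -> 0 < k -> (k * r) `^ p = k `^ gam ->
  open D -> bounded_set D -> open B -> B `<=` D ->
  local_minimizer p lp lm gam D u ->
  local_minimizer p lp lm gam (aff z r @^-1` B) (fun x => k * u (aff z r x)).
Proof.
move=> p1 lp0 lm0 gamp r0 k0 kr oD bD oB BD [G WG minG].
have p0 : 0 < p by exact: lt_trans p1.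
have r1 : r != 0 by rewrite gt_eqF.
have k1 : k != 0 by rewrite gt_eqF.
have kr0 : 0 < k * r by exact: mulr_gt0.
have mD : mset D by exact: measurable_open.
have mB : mset B by exact: measurable_open.
have WB := W1p_subset _ _ _ _ _ mB mD BD WG.
exists (fun x => (k * r) *: G (aff z r x)); first exact: W1p_comp_aff.
move=> E' phi H oE' E'B Wphi.
pose E := aff_inv z r @^-1` E'.
have oE : open E by exact: open_preimage_aff.
have mE : mset E by exact: measurable_open.
have [cE EB] : compactly_contained E B.
  rewrite -[B](preimage_aff_inv z r)//.
  by apply: compactly_contained_preimage_aff; rewrite ?invr_eq0.
have Wpsi := W1p0_comp_aff p k^-1 (- (r^-1 *: z)) r^-1 _ _ _ _ _
  (measurable_open _ oE') Wphi.
move: Wpsi; rewrite !invr_gt0 -/(aff_inv z r) -/E => /(_ r0 k0).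
set psi := (fun x => k^-1 * _); set Hpsi := (fun x => _ *: _) => Wpsi.
have phiE x : phi x = k * psi (aff z r x).
  by rewrite /psi /= affK// mulrA mulfV// mul1r.
have HE x : H x = (k * r) *: Hpsi (aff z r x).
  by rewrite /Hpsi /= affK// scalerA -invfM mulfV ?scale1r// gt_eqF.
have cED : compactly_contained E D by split=> //; exact: subset_trans BD.
have Jle := minG _ _ _ oE cED Wpsi.
have [[[mpsi _] mHpsi _] psi0 _] := Wpsi.
have mu : mfun D u by case: WG => -[].
have mG i : mfun D (fun x => G x 0 i) by case: WG => _ /(_ i)[].
have mu' : mfun D (u \+ psi).
  apply: measurable_funD mu _; apply: (measurable_fun_zero_ext E) mpsi _ => //.
  by move=> x /psi0[].
have mG' i : mfun D (fun x => (G \+ Hpsi) x 0 i).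
  under eq_fun do rewrite mxE.
  apply: measurable_funD (mG i) _.
  apply: (measurable_fun_zero_ext E) (mHpsi i).1 _ => //.
  by move=> x /psi0[_ ->]; rewrite mxE.
have JB : (functionalJ p lp lm gam B u G <=
    functionalJ p lp lm gam B (u \+ psi)%R (G \+ Hpsi)%R)%E.
  have d0 (v : 'rV[R]_n.+1 -> R) Gv x := density_ge0 p lp lm gam v Gv x p0 lp0 lm0.
  have md := measurable_density p lp lm gam _ _ _ mD mu mG.
  have md' := measurable_density p lp lm gam _ _ _ mD mu' mG'.
  have J_lty := functionalJ_lty p lp lm gam D u G p1 lp0 lm0 gamp oD bD WG.
  apply: (int_Rn_localize B D (density p lp lm gam u G)
    (density p lp lm gam (u \+ psi) (G \+ Hpsi)) mB mD BD md md'
    (d0 _ _) (d0 _ _) _ J_lty Jle) => x nBx.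
  have nEx : ~ E x by move=> Ex; apply/nBx/EB/subset_closure.
  have [px Hx] := psi0 _ nEx.
  by rewrite /density /funrpos /funrneg /= px Hx !addr0.
rewrite (functionalJ_comp_aff _ _ _ _ _ _ _ _ _ _ r0 k0 kr mB
  (measurable_funS mD BD mu) (fun i => measurable_funS mD BD (mG i))).
rewrite (_ : ((fun x => k * u (aff z r x)) \+ phi)%R =
    (fun x => k * (u \+ psi) (aff z r x))); last first.
  by apply/funext => x /=; rewrite phiE mulrDr.
rewrite (_ : ((fun x => (k * r) *: G (aff z r x)) \+ H)%R =
    (fun x => (k * r) *: (G \+ Hpsi) (aff z r x))); last first.
  by apply/funext => x /=; rewrite HE scalerDr.
rewrite (functionalJ_comp_aff _ _ _ _ _ _ _ _ _ _ r0 k0 kr mB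
  (measurable_funS mD BD mu') (fun i => measurable_funS mD BD (mG' i))).
by rewrite lee_pmul2l// lte_fin mulr_gt0 ?powR_gt0// exprn_gt0 ?invr_gt0.
Qed.

(** * The C^{1,a} norm and C^1 local minimizers under affine maps *)

Lemma enorm_aff_sub z r (x y : 'rV[R]_n.+1) : 0 < r ->
  enorm (aff z r x - aff z r y) = r * enorm (x - y).
Proof.
move=> r0; rewrite -(gtr0_norm r0) -enormZ (gtr0_norm r0); congr enorm.
by apply/rowP => i; rewrite !mxE; ring.
Qed.

(** The three suprema are multiplied by k, k r and k r r^a respectively. *)
Lemma C1a_norm_comp_aff a k z r D u : 0 < r -> 0 < k ->
  (forall x, D x -> differentiable u x) ->
  (C1a_norm a D u < +oo)%E ->
  (C1a_norm a (aff z r @^-1` D) (fun x => k * u (aff z r x))%R < +oo)%E.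
Proof.
move=> r0 k0 du; have r1 : r != 0 by rewrite gt_eqF.
have kr0 : 0 < k * r by exact: mulr_gt0.
have kra0 : 0 < k * r * r `^ a by rewrite mulr_gt0 ?powR_gt0.
have gradE x : D (aff z r x) ->
    grad (fun x => k * u (aff z r x)) x = (k * r) *: grad u (aff z r x).
  by move=> Dx; apply: grad_comp_aff; exact: du.
rewrite /C1a_norm.
set S1 := [set _ | x in D]; set S2 := [set _ | x in D]; set S3 := image _ _.
set T1 := [set _ | x in _]; set T2 := [set _ | x in _]; set T3 := image _ _.
have -> : T1 = [set (k%:E * e)%E | e in S1].
  apply/seteqP; split => [_ [x Dx <-]|_ [_ [y Dy <-] <-]].
    by exists (`|u (aff z r x)|%:E); [exists (aff z r x)|rewrite normrM gtr0_norm].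
  by exists (aff_inv z r y); rewrite /= ?aff_invK// normrM gtr0_norm.
have -> : T2 = [set ((k * r)%:E * e)%E | e in S2].
  apply/seteqP; split => [_ [x Dx <-]|_ [_ [y Dy <-] <-]].
    exists (enorm (grad u (aff z r x)))%:E; first by exists (aff z r x).
    by rewrite gradE// enormZ gtr0_norm.
  exists (aff_inv z r y); rewrite /= ?aff_invK//.
  by rewrite gradE ?aff_invK// enormZ gtr0_norm.
have quotE x y : D (aff z r x) -> D (aff z r y) ->
    enorm (grad (fun x => k * u (aff z r x)) x - grad (fun x => k * u (aff z r x)) y) /
      enorm (x - y) `^ a =
    k * r * r `^ a * (enorm (grad u (aff z r x) - grad u (aff z r y)) /
      enorm (aff z r x - aff z r y) `^ a).
  move=> Dx Dy; rewrite !gradE// -scalerBr enormZ (gtr0_norm kr0) enorm_aff_sub//.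
  rewrite [(r * _) `^ a]powRM ?enorm_ge0 ?(ltW r0)// invfM.
  have ra : r `^ a != 0 by rewrite gt_eqF ?powR_gt0.
  move: (enorm _) (enorm _ `^ a)^-1 => E X.
  rewrite [RHS](_ : _ = (r `^ a / r `^ a) * (k * r * E * X)); last by ring.
  by rewrite mulfV// mul1r.
have -> : T3 = [set ((k * r * r `^ a)%:E * e)%E | e in S3].
  apply/seteqP; split => [_ [[x y] [/= Dx Dy xy] <-]|_ [_ [[x y] [/= Dx Dy xy] <-] <-]].
    exists (enorm (grad u (aff z r x) - grad u (aff z r y)) /
      enorm (aff z r x - aff z r y) `^ a)%:E; last by rewrite quotE.
    exists (aff z r x, aff z r y) => //; split => //=.
    by apply: contra xy => /eqP/(can_inj (affK z r r1)) ->.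
  exists (aff_inv z r x, aff_inv z r y); last by rewrite /= quotE ?aff_invK.
  split; rewrite /= ?aff_invK//.
  by apply: contra xy => /eqP/(can_inj (aff_invK z r r1)) ->.
rewrite !ereal_sup_pZl//.
(* A supremum over an empty set is -oo, and -oo absorbs +oo in a sum, so finiteness of the sum does
   not bound its terms one by one; all cases are checked. *)
by case: (ereal_sup S1) (ereal_sup S2) (ereal_sup S3) => [x1| |] [x2| |] [x3| |];
  rewrite ?gt0_muley ?gt0_muleNy ?lte_fin// => _; rewrite -?EFinM -?EFinD ltry.
Qed.

Lemma C1_local_minimizer_comp_aff p lp lm gam k z r D B u :
  1 < p -> 0 < lp -> 0 < lm -> 0 < gam < p ->
  0 < r -> 0 < k -> (k * r) `^ p = k `^ gam ->
  open D -> bounded_set D -> open B -> B `<=` D ->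
  C1_local_minimizer p lp lm gam D u ->
  C1_local_minimizer p lp lm gam (aff z r @^-1` B) (fun x => k * u (aff z r x)).
Proof.
move=> p1 lp0 lm0 gamp r0 k0 kr oD bD oB BD [minu [a a01 [du ua]]].
have r1 : r != 0 by rewrite gt_eqF.
split; first exact: (local_minimizer_comp_aff _ _ _ _ _ _ _ D).
exists a => //; split => [x Bx|D' oD' D'B].
  by apply: differentiable_comp_aff; exact/du/BD.
have -> : D' = aff z r @^-1` (aff_inv z r @^-1` D').
  by apply/seteqP; split => x /=; rewrite affK.
have [cE EB] : compactly_contained (aff_inv z r @^-1` D') B.
  rewrite -[B](preimage_aff_inv z r)//.
  by apply: compactly_contained_preimage_aff; rewrite ?invr_eq0.
apply: C1a_norm_comp_aff => // [x /subset_closure/EB/BD|]; first exact: du.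
apply: ua; first exact: open_preimage_aff.
by split => //; exact: subset_trans BD.
Qed.

End scaling.

(** * The lower bound *)

Lemma is_diff_line (R : realType) (V : normedModType R) (y h : V) (t : R) :
  is_diff t (fun t : R => y + t *: h) (fun s : R => s *: h).
Proof.
have H : is_diff t (cst y + *:%R ^~ h) (0 + *:%R ^~ h) by apply: is_diffD.
by apply: (is_diff_eq H); apply/funext => s; rewrite /= add0r.
Qed.

Section balls.
Context {R : realType} {n : nat}.
Implicit Types (A D : set 'rV[R]_n.+1) (x y z w : 'rV[R]_n.+1) (r C a : R)
  (f u : 'rV[R]_n.+1 -> R).

Lemma continuous_line y h : continuous (fun t : R => y + t *: h).
Proof.
move=> t; apply: differentiable_continuous.
by have [] := is_diff_line R _ y h t.
Qed.

(** The segment from [y] to [w] stays in the ball by convexity; the one-dimensional mean value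
    theorem along it is combined with Cauchy-Schwarz. *)
Lemma eball_lipschitz f x r C y w :
  (forall v, eball x r v -> differentiable f v) ->
  (forall v, eball x r v -> enorm (grad f v) <= C) ->
  eball x r y -> eball x r w -> `|f w - f y| <= C * enorm (w - y).
Proof.
move=> df gC By Bw; pose h : 'rV[R]_n.+1 := w - y.
pose path (t : R) : 'rV[R]_n.+1 := y + t *: h.
have Bpath (t : R) : t \in `[0, 1] -> eball x r (path t).
  by rewrite in_itv /= => t01; exact: eball_segment.
have dg (t : R) : t \in `[0, 1] ->
    is_derive t 1 (f \o path) (dotv (grad f (path t)) h).
  move=> t01; have dft := df _ (Bpath _ t01).
  have df' : is_diff (path t) f ('d f (path t)) by exact: DiffDef.
  have dp := is_diff_line R _ y h t.
  have dfp : is_diff t (f \o path) ('d f (path t) \o (fun s : R => s *: h)).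
    exact: is_diff_comp.
  apply: DeriveDef; first exact: diff_derivable.
  by rewrite deriveE// diff_val /= scale1r diff_dotv_grad.
have dg' (t : R) : t \in `]0, 1[ ->
    is_derive t 1 (f \o path) (dotv (grad f (path t)) h).
  by move=> t01; apply: dg; exact: subset_itv_oo_cc t01.
have cg : {within `[0, 1], continuous (f \o path)}.
  by apply: derivable_within_continuous => t /dg[].
have [t t01] := MVT_segment ler01 dg' cg.
rewrite /= /path scale1r scale0r addr0 subr0 mulr1 /h.
have -> : y + (w - y) = w by rewrite addrC subrK.
move=> ->.
apply: le_trans (norm_dotv_le _ _) _; rewrite ler_wpM2r ?enorm_ge0//.
exact/gC/Bpath.
Qed.

(** A segment from z inside the ball avoids the boundary of [D], so its part in [D] is relatively
    open and closed; it contains z, hence by connectedness it is the whole segment. *)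
Lemma subset_eball_of_boundary D z r : open D -> D z ->
  (forall b, boundary D b -> r <= enorm (b - z)) -> eball z r `<=` D.
Proof.
move=> oD Dz far y yB; apply: contrapT => nDy.
pose path (t : R) : 'rV[R]_n.+1 := z + t *: (y - z); pose S := path @` `[0, 1].
have p0 : path 0 = z by rewrite /path scale0r addr0.
have p1 : path 1 = y by rewrite /path scale1r addrC subrK.
have cS : connected S.
  apply: connected_continuous_connected; first exact: segment_connected.
  by apply: continuous_subspaceT; exact: continuous_line.
have SB : S `<=` eball z r.
  move=> _ [t /= t01 <-]; apply: eball_segment => //.
  by apply: eball_center; exact: le_lt_trans (enorm_ge0 _) yB.
have SD : S `&` D = S `&` closure D.
  apply/seteqP; split => [v [Sv Dv]|v [Sv cDv]]; split => //.
    exact: subset_closure.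
  apply: contrapT => nDv; have /far : boundary D v.
    by split => // /interior_subset.
  by rewrite leNgt => /negP; apply; exact: SB.
have SDS : S `&` D = S.
  apply: cS.
  - by exists z; split => //; exists 0 => //=; rewrite in_itv /= lexx ler01.
  - by exists D.
  - by exists (closure D) => //; exact: closed_closure.
apply: nDy; suff [] : (S `&` D) y by [].
by rewrite SDS; exists 1 => //=; rewrite in_itv /= lexx ler01.
Qed.

(** Two distinct points are needed for the Hoelder seminorm to be nonnegative:
    on a singleton it is the supremum of the empty set, [-oo]. *)
Lemma C1a_norm_grad_le a C D u x y w : D x -> D y -> D w -> y != w ->
  (C1a_norm a D u <= C%:E)%E -> enorm (grad u x) <= C.
Proof.
move=> Dx Dy Dw yw; rewrite /C1a_norm.
set S1 := [set _ | x in D]; set S2 := [set _ | x in D]; set S3 := image _ _.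
move=> SC; rewrite -lee_fin; apply: le_trans SC.
have s1 : (0 <= ereal_sup S1)%E.
  apply: (@le_trans _ _ (`|u x|%:E)); first by rewrite lee_fin.
  by apply: ereal_sup_ubound; exists x.
have s3 : (0 <= ereal_sup S3)%E.
  apply: (@le_trans _ _ (enorm (grad u y - grad u w) / enorm (y - w) `^ a)%:E).
    by rewrite lee_fin divr_ge0 ?powR_ge0 ?enorm_ge0.
  by apply: ereal_sup_ubound; exists (y, w).
apply: (@le_trans _ _ (ereal_sup S2)); first by apply: ereal_sup_ubound; exists x.
by rewrite -[leLHS]adde0 leeD// -[leLHS]add0e leeD.
Qed.

Lemma lebesgue_outer_eball_center x y r :
  lebesgue_outer (eball x r) = lebesgue_outer (eball y r).
Proof.
rewrite (_ : eball x r = aff (y - x) 1 @^-1` eball y r).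
  by rewrite lebesgue_outer_preimage_aff// invr1 expr1n mul1e.
have E w : y - x + 1 *: w - y = w - x by apply/rowP => i; rewrite !mxE; ring.
by apply/seteqP; split => w; rewrite /eball /aff /= E.
Qed.

End balls.

Section signed_part.
Context {R : realType} {m : nat}.
Implicit Types (u : 'rV[R]_m -> R) (x y : 'rV[R]_m).

Lemma signed_part_le_norm s u x : signed_part s u x <= `|u x|.
Proof.
case: s; rewrite /signed_part /funrpos /funrneg ge_max normr_ge0 andbT.
  exact: ler_norm.
by rewrite -normrN ler_norm.
Qed.

(** Taking the positive or negative part is 1-Lipschitz. Thus the mean value estimate can be made
    for the differentiable function and then passed to its signed part, which may have corners. *)
Lemma signed_partB_le s u x y :
  signed_part s u x - signed_part s u y <= `|u x - u y|.
Proof.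
have := ler_norm (u x - u y); have := ler_norm (- (u x - u y)); rewrite normrN.
have := normr_ge0 (u x - u y).
case: s; rewrite /signed_part /funrpos /funrneg !maxEle;
  by do 2?case: ifPn; rewrite -?ltNge => *; lra.
Qed.

End signed_part.

Theorem lemma5p1 (R : realType) (n : nat) (p lp lm gam a : R) :
  1 < p -> 0 < lp -> 0 < lm ->
  0 < gam ->
  gam < Num.min 1 (p * alpha_p n p / (1 + alpha_p n p)) ->
  0 < a < 1 ->
  let tau := gam / (p - gam) in
  forall (s : bool) (C1 cs : R), 0 < C1 -> 0 < cs ->
  exists2 c : R, 0 < c &
    forall (Omega Omega' : set 'rV[R]_n.+1) (u : 'rV[R]_n.+1 -> R)
      (rho0 C2 : R),
    open Omega -> bounded_set Omega -> lipschitz_boundary Omega ->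
    C1_local_minimizer p lp lm gam Omega u ->
    open Omega' -> compactly_contained Omega' Omega ->
    growth_constants tau Omega Omega' u rho0 C2 ->
    nondegeneracy_constant tau Omega (signed_part s u) cs ->
    interior_constant n p lp lm gam a C2 C1 ->
    forall z : 'rV[R]_n.+1,
    (free_boundary0 Omega u `&`
     boundary (positivity_set Omega (signed_part s u)) `&` Omega') z ->
    forall r : R, 0 < r < rho0 ->
    (lebesgueN R n (eball 0 (c * r)%R) <=
     lebesgueN R n
       ((Omega `&` [set x | 0 < signed_part s u x <= C2 * r `^ (1 + tau)]%R)
        `&` eball z r))%E.
Proof.
move=> p1 lp0 lm0 gam0; rewrite lt_min => /andP[gam1 _] _ tau s C1 cs C10 cs0.
have gamp : gam < p by exact: lt_trans p1.
(* [q] is the power of 1/4 left by nondegeneracy at radius r/4 after scaling. Halving in [mu] gives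
   a value strictly below the supremum, hence exceeded at some point. *)
pose q : R := 4^-1 `^ (1 + tau); pose mu := cs * q / 2.
have q0 : 0 < q by rewrite powR_gt0 ?invr_gt0.
have mu0 : 0 < mu by rewrite divr_gt0// mulr_gt0.
(* The first bound keeps the ball of radius [c] about a point of B_{1/4} in the half ball; the
   second limits the variation of [v] on it to [mu / 2]. *)
pose c := Num.min 4^-1 (mu / (2 * C1)).
have c0 : 0 < c by rewrite lt_min invr_gt0 ltr0n divr_gt0// mulr_gt0.
have c4 : c <= 4^-1 by rewrite ge_min lexx.
have C1c : C1 * c <= mu / 2.
  have h : c <= mu / (2 * C1) by rewrite ge_min lexx orbT.
  apply: le_trans (ler_wpM2l (ltW C10) h) _.
  by rewrite invfM mulrCA (mulrCA C1) mulfV ?mulr1// gt_eqF.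
exists c => // Omega Omega' u rho0 C2 oO bO _ minu _ [cO' O'O]
  [rho00 rho0d C20 growth] nondeg interior z [[zG zpos] zO'] r /andP[r0 rrho].
have r1 : r != 0 by rewrite gt_eqF.
have Oz : Omega z by exact/O'O/subset_closure.
have rfar b : boundary Omega b -> rho0 <= enorm (b - z).
  move=> bb; rewrite -lee_fin; apply: le_trans (ltW rho0d) _.
  by apply: ereal_inf_lbound; exists (z, b) => //=; rewrite enormB.
have BO : eball z r `<=` Omega.
  apply: subset_eball_of_boundary => // b /rfar; exact/le_trans/ltW.
pose k := (r `^ (1 + tau))^-1.
have k0 : 0 < k by rewrite invr_gt0 powR_gt0.
(* Here k r = r^-tau, and tau p = (1 + tau) gam by the choice of tau. *)
have kr : (k * r) `^ p = k `^ gam.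
  have krE : k * r = r `^ (- (1 + tau) + 1).
    have h : (- (1 + tau) + 1 == 0) ==> (r != 0) by rewrite r1 implybT.
    by rewrite (powRD h) powRN powRr1 ?(ltW r0).
  rewrite krE /k -powRN -!powRrM; congr (_ `^ _); rewrite /tau; field.
  by rewrite subr_eq0 gt_eqF.
have BE : aff z r @^-1` eball z r = eball 0 1.
  apply/seteqP; split => x; rewrite /eball /aff /= subr0 addrAC subrr add0r.
    by rewrite enormZ gtr0_norm// gtr_pMr.
  by rewrite enormZ gtr0_norm// gtr_pMr.
pose v x := k * u (aff z r x).
have minv : C1_local_minimizer p lp lm gam (eball 0 1) v.
  rewrite -BE; apply: (C1_local_minimizer_comp_aff _ _ _ _ _ _ _ Omega) => //.
  - by rewrite gam0.
  - exact: open_eball.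
have ubound y : eball z r y -> `|u y| <= C2 * r `^ (1 + tau).
  move=> yB; rewrite -lee_fin; have /= := growth z r (conj zG zO'); rewrite r0 rrho.
  by move=> /(_ isT); apply: le_trans; apply: ereal_sup_ubound; exists y.
have vbound x : eball 0 1 x -> `|v x| <= C2.
  rewrite -BE /v normrM (gtr0_norm k0) => /ubound h.
  by rewrite mulrC ler_pdivrMr// powR_gt0.
have gradv x : eball 0 2^-1 x -> enorm (grad v x) <= C1.
  (* The points 0 and [e] are the two distinct points of the half ball that [C1a_norm_grad_le] asks
     for. *)
  move=> xB; pose e : 'rV[R]_n.+1 := 4^-1 *: delta_mx 0 0.
  have e0 : 0 != e.
    apply/eqP => /rowP/(_ 0); rewrite !mxE !eqxx mulr1 => /esym/eqP.
    by rewrite invr_eq0 pnatr_eq0.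
  have enorm_e : enorm e = 4^-1.
    rewrite enormZ gtr0_norm// /enorm /dotv (bigD1 0)//= big1 => [|i /negbTE i0].
      by rewrite !mxE !eqxx mulr1 addr0 sqrtr1 mulr1.
    by rewrite !mxE i0 andbF mulr0.
  apply: (C1a_norm_grad_le a _ _ _ _ 0 e xB _ _ e0); last exact: interior.
    by apply: eball_center; rewrite invr_gt0.
  by rewrite /eball /= subr0 enorm_e ltf_pV2 ?posrE ?ltr_nat.
have B2 : eball (0 : 'rV[R]_n.+1) 2^-1 `<=` eball 0 1.
  by apply: subset_eball; rewrite subrr enorm0 add0r invf_le1 ?ler1n.
have dv x : eball 0 2^-1 x -> differentiable v x.
  by case: minv => _ [b _ [dv _]] /B2; exact: dv.
(* Nondegeneracy applies at z, which lies in the closure of the positivity set; half of its lower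
   bound is strictly below the supremum. *)
have [y yB yu] : exists2 y, eball z (r / 4) y &
    cs * (r / 4) `^ (1 + tau) / 2 < signed_part s u y.
  have r40 : 0 < r / 4 by rewrite divr_gt0.
  have rpos : 0 < cs * (r / 4) `^ (1 + tau) by rewrite mulr_gt0 ?powR_gt0.
  have rd : ((r / 4)%:E < set_dist [set z] (boundary Omega))%E.
    apply: (@lt_le_trans _ _ rho0%:E).
      rewrite lte_fin; apply: le_lt_trans rrho.
      by rewrite ler_pdivrMr// ler_peMr ?(ltW r0)// ler1n.
    apply: (le_trans (ltW rho0d)); apply: ereal_inf_le_tmp => _ [[w b] [/= -> bb] <-].
    by exists (z, b).
  have half : ((cs * (r / 4) `^ (1 + tau) / 2)%:E <
      ereal_sup [set (signed_part s u y)%:E | y in eball z (r / 4)])%E.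
    apply: (lt_le_trans _ (nondeg z (r / 4) zpos.1 r40 rd)).
    by rewrite lte_fin ltr_pdivrMr// ltr_pMr// ltr1n.
  by have [_ [y yB <-]] := ereal_sup_gt half; rewrite lte_fin; exists y.
pose x0 := aff_inv z r y.
have yE : y = aff z r x0 by rewrite aff_invK.
have x0B : enorm x0 < 4^-1.
  move: yB; rewrite /eball /= yE /aff addrAC subrr add0r enormZ gtr0_norm//.
  by rewrite ltr_pM2l.
have yc : eball y (c * r) `<=`
    (Omega `&` [set x | 0 < signed_part s u x <= C2 * r `^ (1 + tau)]) `&`
    eball z r.
  move=> w wy; pose x := aff_inv z r w.
  have wE : w = aff z r x by rewrite aff_invK.
  have xx0 : enorm (x - x0) < c.
    by move: wy; rewrite /eball /= wE yE enorm_aff_sub// mulrC ltr_pM2r.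
  have x0B2 : eball 0 2^-1 x0.
    by rewrite /eball /= subr0; apply: lt_trans x0B _; rewrite ltf_pV2 ?posrE ?ltr_nat.
  have xB2 : eball 0 2^-1 x.
    rewrite /eball /= subr0 -(subrK x0 x); apply: le_lt_trans (enorm_triangle _ _) _.
    by have := lt_le_trans xx0 c4; lra.
  have wB : eball z r w.
    have : (aff z r @^-1` eball z r) x by rewrite BE; exact: B2.
    by rewrite /= -wE.
  have vx : `|v x0 - v x| <= mu / 2.
    apply: le_trans (eball_lipschitz v _ _ C1 _ _ dv gradv xB2 x0B2) _.
    by apply: le_trans C1c; rewrite enormB ler_wpM2l ?ltW.
  have ky : mu < k * signed_part s u y.
    move: yu; rewrite -(ltr_pM2l k0); apply: le_lt_trans.
    rewrite powRM ?invr_ge0 ?(ltW r0)// -/q /mu /k.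
    rewrite [leRHS](_ : _ =
      ((r `^ (1 + tau))^-1 * r `^ (1 + tau)) * (cs * q / 2)); last by ring.
    by rewrite mulVf ?mul1r// gt_eqF ?powR_gt0.
  (* The scaled signed part exceeds [mu] at y and drops by at most [mu / 2] on the way to w. *)
  have kw : 0 < k * signed_part s u w.
    have : k * (signed_part s u y - signed_part s u w) <= mu / 2.
      apply: le_trans vx; rewrite /v -mulrBr normrM (gtr0_norm k0) -yE -wE.
      by rewrite ler_pM2l// signed_partB_le.
    by rewrite mulrBr; lra.
  split=> //; split; first exact: BO.
  by rewrite /= -(pmulr_rgt0 _ k0) kw (le_trans (signed_part_le_norm _ _ _)) ?ubound.
(* Translation invariance moves the ball from 0 to y, where the inclusion [yc] and monotonicity
   conclude. *)
apply: (@le_trans _ _ (lebesgueN R n (eball y (c * r)))).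
  by rewrite [leLHS](lebesgue_outer_eball_center 0 y).
exact: le_lebesgue_outer.
Qed.
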